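(* Let $D$ be a bounded domain in $\mathbb{R}^m$, $m \geq 2$, and let $u \in C^0(D)$. For $x \in D$ and $0 < r_1 < r_2$ put $A_x(r_1,r_2) = \{ y \in \mathbb{R}^m : r_1 < |x-y| < r_2 \}$, and call $B_{r_2}(x) = \{y : |y-x|<r_2\}$ admissible if $\overline{B_{r_2}(x)} \subset D$. Suppose that $$\frac{1}{|A_x(r_1,r_2)|}\int_{A_x(r_1,r_2)} u(y)\,\mathrm{d}y \;=\; \frac{1}{\omega_m r^{m-1}} \int_{S_r(x)} u(y)\,\mathrm{d}S_y$$ holds for every $x \in D$ and every $r_2 > r_1 > 0$ such that $B_{r_2}(x)$ is admissible, where $S_r(x)=\{y : |y-x| = r\}$ and $r$ is subject to one of the following: either the identity holds for every $r \in (r_1,r_2)$, or it holds with $r = r_1$, or it holds with $r = r_2$. Then $u$ is harmonic in $D$.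
   Context: $|A|$ denotes Lebesgue measure (volume) of $A$, $\mathrm{d}S$ is the surface area measure, and $\omega_m = 2\pi^{m/2}/\Gamma(m/2)$ is the area of the unit sphere in $\mathbb{R}^m$, so the right-hand side is the mean value of $u$ over the sphere $S_r(x)$. *)

(* Defs.v *)
From HB Require Import structures.
From mathcomp Require Import all_boot all_order all_algebra.
From mathcomp Require Import all_classical all_reals all_analysis.
Set Implicit Arguments. Unset Strict Implicit. Unset Printing Implicit Defensive.
Import Order.TTheory GRing.Theory Num.Theory.
Import numFieldNormedType.Exports.
Local Open Scope classical_set_scope.
Local Open Scope ring_scope.

Section defs.
Variable R : realType.

Definition enorm (m : nat) (v : 'rV[R]_m) : R :=
  Num.sqrt (\sum_(i < m) (v 0 i) ^+ 2).

(* Lebesgue integral over R^m, realised as the iterated one-dimensional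
   Lebesgue integral (product Lebesgue measure, Fubini), coordinate 0 outermost. *)
Fixpoint iint (m : nat) (f : seq R -> R) : R :=
  match m with
  | 0 => f [::]
  | m'.+1 => Rintegral (@lebesgue_measure R) setT
               (fun t : R => iint m' (fun s => f (t :: s)))
  end.

Definition row_of_seq (m : nat) (s : seq R) : 'rV[R]_m := \row_(i < m) nth 0 s i.

Definition Rm_integral (m : nat) (A : set 'rV[R]_m) (f : 'rV[R]_m -> R) : R :=
  iint m (fun s => (\1_A (row_of_seq m s)) * f (row_of_seq m s)).

Definition Rm_volume (m : nat) (A : set 'rV[R]_m) : R := Rm_integral A (fun _ => 1).

Definition eopen_ball (m : nat) (x : 'rV[R]_m) (r : R) : set 'rV[R]_m :=
  [set y | enorm (y - x) < r].
Definition eclosed_ball (m : nat) (x : 'rV[R]_m) (r : R) : set 'rV[R]_m :=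
  [set y | enorm (y - x) <= r].

Definition annulus (m : nat) (x : 'rV[R]_m) (r1 r2 : R) : set 'rV[R]_m :=
  [set y | r1 < enorm (x - y) < r2].

(* Surface integral over the sphere S_r(x) = {y : |y - x| = r}, with the
   surface measure sigma on the unit sphere given by the cone construction
   sigma(E) = m |{t w : w in E, 0 < t <= 1}|, i.e.
     \int_{S^{m-1}} g dsigma = m \int_{B_1(0)\{0}} g(y/|y|) dy,
   and dS on S_r(x) the image of r^{m-1} dsigma under w |-> x + r w. *)
Definition sphere_integral (m : nat) (x : 'rV[R]_m) (r : R)
    (u : 'rV[R]_m -> R) : R :=
  r ^+ m.-1 * (m%:R * Rm_integral (eopen_ball 0 1 `\ 0)
                          (fun y => u (x + (r / enorm y) *: y))).

(* Gamma(m/2) for m a positive integer: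
   Gamma(k) = (k-1)!, Gamma(k + 1/2) = (2k)! sqrt(pi) / (4^k k!). *)
Definition gamma_half (m : nat) : R :=
  if odd m then ((m.-1)`!%:R / (4 ^+ (m./2) * (m./2)`!%:R)) * Num.sqrt pi
  else ((m./2).-1)`!%:R.

(* omega_m = 2 pi^{m/2} / Gamma(m/2): area of the unit sphere of R^m *)
Definition omega (m : nat) : R := 2 * (Num.sqrt pi) ^+ m / gamma_half m.

Definition bounded_domain (m : nat) (D : set 'rV[R]_m) : Prop :=
  open D /\ connected D /\ D !=set0 /\ exists M : R, forall y, D y -> enorm y <= M.

Definition ebasis (m : nat) (i : 'I_m) : 'rV[R]_m := delta_mx 0 i.
Definition partial (m : nat) (i : 'I_m) (f : 'rV[R]_m -> R) (x : 'rV[R]_m) : R :=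
  'D_(ebasis i) f x.

Definition C2_on (m : nat) (D : set 'rV[R]_m) (u : 'rV[R]_m -> R) : Prop :=
  forall x, D x ->
    {for x, continuous u} /\
    forall i : 'I_m,
      derivable u x (ebasis i) /\ {for x, continuous (partial i u)} /\
      forall j : 'I_m,
        derivable (partial i u) x (ebasis j) /\
        {for x, continuous (partial j (partial i u))}.

Definition laplacian (m : nat) (u : 'rV[R]_m -> R) (x : 'rV[R]_m) : R :=
  \sum_(i < m) partial i (partial i u) x.

Definition harmonic_on (m : nat) (D : set 'rV[R]_m) (u : 'rV[R]_m -> R) : Prop :=
  C2_on D u /\ forall x, D x -> laplacian u x = 0.

Definition annulus_sphere_identity (m : nat) (u : 'rV[R]_m -> R)
    (x : 'rV[R]_m) (r1 r2 r : R) : Prop :=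
  Rm_integral (annulus x r1 r2) u / Rm_volume (annulus x r1 r2)
  = sphere_integral x r u / (omega m * r ^+ m.-1).

End defs.

(* Main.v *)
Require Import Defs.
From HB Require Import structures.
From mathcomp Require Import all_boot all_order all_algebra.
From mathcomp Require Import all_classical all_reals all_analysis.
From mathcomp Require Import measurable_realfun ring lra.
Import Order.TTheory GRing.Theory Num.Theory.
Import numFieldNormedType.Exports.
Local Open Scope classical_set_scope.
Local Open Scope ring_scope.
Set Implicit Arguments.
Unset Strict Implicit.
Unset Printing Implicit Defensive.

(** The right-hand side enters only as some function of the centre and of the
   radius [r], so neither polar coordinates nor the value of [omega] is used.
   In the last two cases, subtracting the identities of two annuli sharing
   their prescribed radius shows that [u] has the same mean on a remaining ring
   whatever that radius was, so that the mean over annuli centred at [x] is one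
   constant; letting the inner radius, then the outer radius tend to [0], the
   constant is [u x] and [u] has the ball mean value property.

   Approximating a radial weight by step functions, the mean value property
   extends to the weights [tau^k], [tau = max (rho^2 - |y - x|^2) 0].  Hence [u]
   is locally a multiple of its convolution with [tau^3], which is of class C2.
   The Laplacian of [tau^3] is again a combination of [tau] and [tau^2], so the
   Laplacian of [u] is [u] times a constant that does not depend on [u]; the
   function [1] shows that this constant is [0]. *)

(** Why the cube of [tau]: a power of [tau] is a polynomial on its support, but extended by [0] it
    is only as smooth as its order of vanishing on the sphere, and the third power is the least that
    gives class C2. On the support [|z|^2 = rho^2 - tau], so the factors [|z|^2] that the Laplacian
    produces turn back into [tau]; this keeps the Laplacian among the weights for which the mean
    value property is available.

    The integral is a nest of one-dimensional integrals, and its linearity and monotonicity require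
    every inner integral to be that of an integrable function. Hence the class of integrands is that
    of jointly measurable, bounded functions of bounded support, and [u] is cut off to a
    neighbourhood on which it is continuous and bounded.

    Limits of integrals are always obtained from explicit bounds, never from a convergence theorem:
    a Lipschitz bound for step functions, a quadratic remainder for difference quotients. Such
    bounds pass under the integral by monotonicity alone. *)

(** * Iterated Lebesgue integrals: measurability, linearity, bounds, translations *)

Section iterated_integral.
Context {R : realType}.
Local Notation mR := (measurableTypeR R).
Local Notation mu := (@lebesgue_measure R).

(* Joint measurability of [(x, t_1, ..., t_m) |-> F x [:: t_1; ...; t_m]]; the
   parameter space absorbs the coordinates one at a time, which is how [iint]
   consumes them. *)
Fixpoint jmeas (m : nat) :
    forall d (X : measurableType d), (X -> seq R -> R) -> Prop :=
  match m with
  | 0 => fun d X F => measurable_fun setT (fun x => F x [::])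
  | n.+1 => fun d X F => @jmeas n _ (X * mR)%type (fun p s => F p.1 (p.2 :: s))
  end.
Arguments jmeas m {d X} F.

Lemma jmeas_precomp m d (X : measurableType d) (F : X -> seq R -> R)
    d' (Y : measurableType d') (h : Y -> X) :
  measurable_fun setT h -> jmeas m F -> jmeas m (fun y => F (h y)).
Proof.
elim: m d X F d' Y h => [|m IH] d X F d' Y h mh /=.
  move=> mF; exact: (measurableT_comp mF mh).
move=> JF.
apply: (IH _ _ (fun (p : X * mR) s => F p.1 (p.2 :: s)) _ _
  (fun p : Y * mR => (h p.1, p.2))) => //.
apply: measurable_fun_pair; last exact: measurable_snd.
by apply: (measurableT_comp mh); exact: measurable_fst.
Qed.

Lemma jmeas_comp2 m d (X : measurableType d) (F G : X -> seq R -> R)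
    (g : mR * mR -> mR) : measurable_fun setT g ->
  jmeas m F -> jmeas m G -> jmeas m (fun x s => g (F x s, G x s)).
Proof.
move=> mg; elim: m d X F G => [|m IH] d X F G /=.
  by move=> mF mG; apply: (measurableT_comp mg); exact: measurable_fun_pair.
by move=> JF JG; exact: IH.
Qed.

Lemma jmeas_cvg m d (X : measurableType d) (F : nat -> X -> seq R -> R)
    (G : X -> seq R -> R) : (forall k, jmeas m (F k)) ->
  (forall x s, size s = m -> (F ^~ x) ^~ s @ \oo --> G x s) -> jmeas m G.
Proof.
elim: m d X F G => [|m IH] d X F G /= JF FG.
  apply: (@measurable_fun_cvg _ _ _ setT (fun k x => F k x [::])) => //.
  by move=> x _; exact: FG.
apply: (IH _ _ (fun k (p : X * mR) s => F k p.1 (p.2 :: s))) => //.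
by move=> p s sm; apply: FG; rewrite /= sm.
Qed.

Lemma eq_jmeas m d (X : measurableType d) (F G : X -> seq R -> R) :
  (forall x s, size s = m -> F x s = G x s) -> jmeas m F -> jmeas m G.
Proof.
move=> FG JF; apply: (jmeas_cvg (F := fun=> F)) => // x s sm.
by rewrite -FG//; exact: cvg_cst.
Qed.

(** No integrability is assumed: Tonelli applies to the positive and negative parts separately, and
    both the difference and [fine] are measurable on the extended reals. *)
Lemma measurable_Rintegral d (X : measurableType d) (G : X * mR -> R) :
  measurable_fun setT G ->
  measurable_fun setT (fun x => Rintegral mu setT (fun t => G (x, t))).
Proof.
move=> mG; rewrite /Rintegral.
apply: (measurableT_comp (f := fine)
  (g := fun x => (\int[mu]_t (G (x, t))%:E)%E)) => //.
have mEG : measurable_fun setT (EFin \o G) by exact/measurable_EFinP.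
under eq_fun do rewrite integralE.
apply: emeasurable_funB.
- have := measurable_fun_fubini_tonelli_F (m2 := mu) (EFin \o G)^\+%E
    (measurable_funepos mEG) (fun=> funepos_ge0 _ _).
  apply: eq_measurable_fun => x _; apply: eq_integral => t _.
  by rewrite !funeposE.
- have := measurable_fun_fubini_tonelli_F (m2 := mu) (EFin \o G)^\-%E
    (measurable_funeneg mEG) (fun=> funeneg_ge0 _ _).
  apply: eq_measurable_fun => x _; apply: eq_integral => t _.
  by rewrite !funenegE.
Qed.

Lemma measurable_iint m d (X : measurableType d) (F : X -> seq R -> R) :
  jmeas m F -> measurable_fun setT (fun x => iint m (F x)).
Proof.
elim: m d X F => [|m IH] d X F //= JF.
apply: (@measurable_Rintegral _ X
  (fun p : X * mR => iint m (fun s => F p.1 (p.2 :: s)))).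
exact: IH JF.
Qed.

Definition box (N : R) : pred (seq R) := all (fun t => `|t| <= N).

Definition bsupp m (C N : R) (f : seq R -> R) :=
  forall s, size s = m -> `|f s| <= C * (box N s)%:R.

(** This class is stable under fixing the outer coordinate, so each inner integral is again a
    bounded measurable function of bounded support, hence integrable. *)
Definition adm m (f : seq R -> R) :=
  jmeas m (fun (_ : unit) => f) /\
  exists C N, [/\ 0 <= C, 0 <= N & bsupp m C N f].

Lemma eq_iint m (f g : seq R -> R) : (forall s, size s = m -> f s = g s) ->
  iint m f = iint m g.
Proof.
elim: m f g => [|m IH] f g fg /=; first exact: fg.
congr Rintegral; apply/funext => t; apply: IH => s sm; apply: fg.
by rewrite /= sm.
Qed.

Lemma adm_slice m f (t : R) : adm m.+1 f -> adm m (fun s => f (t :: s)).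
Proof.
move=> [Jf [C [N [C0 N0 fCN]]]]; split.
  apply: (jmeas_precomp (h := fun u : unit => (u, t : mR)) _ Jf).
  by apply: measurable_fun_pair => //; exact: measurable_cst.
exists C, N; split => // s sm.
apply: (le_trans (fCN (t :: s) _)); first by rewrite /= sm.
rewrite /box /=; case: (`|t| <= N) => //=; rewrite mulr0.
by rewrite mulr_ge0.
Qed.

Lemma integrable_bounded (G : R -> R) (C N : R) : 0 <= C ->
  measurable_fun (setT : set mR) G -> (forall t, `|G t| <= C * (`|t| <= N)%R%:R) ->
  mu.-integrable setT (EFin \o G).
Proof.
move=> C0 mG GC.
have iI : mu.-integrable setT (EFin \o (fun t => C * \1_(`[-N, N]) t)).
  have := integrableZl measurableT C (integrable_indic_itv (- N) N true false).
  by apply: eq_integrable => // t _; rewrite /= EFinM.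
apply: le_integrable iI => //; first exact/measurable_EFinP.
move=> t _ /=; rewrite lee_fin; apply: (le_trans (GC t)).
rewrite [X in _ <= X]ger0_norm; last by rewrite mulr_ge0.
by rewrite indicE mem_setE in_itv /= ler_norml.
Qed.

Lemma measurable_box (N : R) :
  measurable_fun (setT : set mR) (fun t : R => (`|t| <= N)%R%:R : R).
Proof.
rewrite (_ : (fun _ => _) = (\1_(`[-N, N]) : mR -> R)).
  by apply: measurable_indic; exact: measurable_itv.
by apply/funext => t; rewrite indicE mem_setE in_itv /= ler_norml.
Qed.

Lemma Rintegral_box (C N : R) : 0 <= N ->
  Rintegral mu setT (fun t : R => C * (`|t| <= N)%R%:R) = C * (N *+ 2).
Proof.
move=> N0.
rewrite (_ : (fun t => _) = (fun t => C * \1_(`[-N, N]) t)); last first.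
  by apply/funext => t; rewrite indicE mem_setE in_itv /= ler_norml.
rewrite RintegralZl//; last exact: integrable_indic_itv.
congr (_ * _).
rewrite /Rintegral integral_indic// setIT.
rewrite [X in fine X](lebesgue_measure_itv `[- N, N])/= lte_fin.
case: ltP => [_|N0']; first by rewrite opprK mulr2n.
have -> : N = 0 by lra.
by rewrite mul0rn.
Qed.

Lemma iint_bound m f (C N : R) : 0 <= C -> 0 <= N ->
  jmeas m (fun (_ : unit) => f) -> bsupp m C N f ->
  `|iint m f| <= C * (N *+ 2) ^+ m.
Proof.
elim: m f C => [|m IH] f C C0 N0 Jf fCN /=.
  by have := fCN [::] erefl; rewrite /= !mulr1.
have mG : measurable_fun setT (fun t : mR => iint m (fun s => f (t :: s))).
  apply: (measurable_iint (F := fun t : mR => fun s => f (t :: s))).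
  apply: (jmeas_precomp (h := fun t : mR => (tt, t)) _ Jf).
  by apply: measurable_fun_pair => //; exact: measurable_cst.
have sl (t : R) : `|iint m (fun s => f (t :: s))|
    <= (C * (N *+ 2) ^+ m) * (`|t| <= N)%R%:R.
  (* For fixed [t] the indicator of [|t| <= N] is absorbed into the constant, so the induction
     hypothesis is used with a bound that is zero for large [t]. *)
  rewrite mulrAC; apply: IH => //.
  - by rewrite mulr_ge0.
  - apply: (jmeas_precomp (h := fun u : unit => (u, t : mR)) _ Jf).
    by apply: measurable_fun_pair => //; exact: measurable_cst.
  move=> s sm; apply: (le_trans (fCN (t :: s) _)); first by rewrite /= sm.
  by rewrite /box /= -mulrA -natrM mulnb.
have C'0 : 0 <= C * (N *+ 2) ^+ m.
  by rewrite mulr_ge0// exprn_ge0// mulrn_wge0.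
have iG := integrable_bounded C'0 mG sl.
apply: (le_trans (le_normr_Rintegral _ _)) => //.
rewrite exprSr mulrA -(Rintegral_box (C * (N *+ 2) ^+ m))//.
apply: le_Rintegral => //; first exact/(integrable_norm iG).
apply: (@integrable_bounded _ (C * (N *+ 2) ^+ m) N) => //.
  by apply: measurable_funM => //; exact: measurable_box.
by move=> t; rewrite ger0_norm// mulr_ge0.
Qed.

Lemma measurable_slice m (f : seq R -> R) : jmeas m.+1 (fun (_ : unit) => f) ->
  measurable_fun (setT : set mR) (fun t => iint m (fun s => f (t :: s))).
Proof.
move=> Jf; apply: (measurable_iint (F := fun t : mR => fun s => f (t :: s))).
apply: (jmeas_precomp (h := fun t : mR => (tt, t)) _ Jf).
by apply: measurable_fun_pair => //; exact: measurable_cst.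
Qed.

Lemma jmeas_slice m (f : seq R -> R) t : jmeas m.+1 (fun (_ : unit) => f) ->
  jmeas m (fun (_ : unit) s => f (t :: s)).
Proof.
move=> Jf; apply: (jmeas_precomp (h := fun u : unit => (u, t : mR)) _ Jf).
by apply: measurable_fun_pair => //; exact: measurable_cst.
Qed.

Lemma integrable_slice m f : adm m.+1 f ->
  mu.-integrable setT (EFin \o (fun t => iint m (fun s => f (t :: s)))).
Proof.
move=> [Jf [C [N [C0 N0 fCN]]]].
apply: (@integrable_bounded _ (C * (N *+ 2) ^+ m) N).
- by rewrite mulr_ge0// exprn_ge0// mulrn_wge0.
- exact: measurable_slice.
move=> t; rewrite mulrAC; apply: iint_bound => //.
- by rewrite mulr_ge0.
- exact: jmeas_slice.
move=> s sm; apply: (le_trans (fCN (t :: s) _)); first by rewrite /= sm.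
by rewrite /box /= -mulrA -natrM mulnb.
Qed.

Lemma iintZ m c f : adm m f -> iint m (fun s => c * f s) = c * iint m f.
Proof.
elim: m f => [|m IH] f af //=.
rewrite -RintegralZl//; last exact: integrable_slice.
by apply: eq_Rintegral => t _; apply: IH; exact: adm_slice.
Qed.

Lemma iintD m f g : adm m f -> adm m g ->
  iint m (fun s => f s + g s) = iint m f + iint m g.
Proof.
elim: m f g => [|m IH] f g af ag //=.
rewrite -RintegralD//; [|exact: integrable_slice..].
by apply: eq_Rintegral => t _; apply: IH; exact: adm_slice.
Qed.

Lemma le_iint m f g : adm m f -> adm m g ->
  (forall s, size s = m -> f s <= g s) -> iint m f <= iint m g.
Proof.
elim: m f g => [|m IH] f g af ag fg /=; first exact: fg.
apply: le_Rintegral => //; [exact: integrable_slice..|].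
move=> t _; apply: IH => [| |s sm]; [exact: adm_slice..|].
by apply: fg; rewrite /= sm.
Qed.

Lemma adm_linear m a b f g : adm m f -> adm m g ->
  adm m (fun s => a * f s + b * g s).
Proof.
move=> [Jf [C [N [C0 N0 fCN]]]] [Jg [C' [N' [C'0 N'0 gCN]]]]; split.
  apply: (jmeas_comp2 (g := fun p : mR * mR => a * p.1 + b * p.2)) => //.
  by apply: measurable_funD; apply: measurable_funM.
exists (`|a| * C + `|b| * C'), (Num.max N N'); split.
- by rewrite addr_ge0// mulr_ge0.
- by rewrite le_max N0.
have bx n s : n <= Num.max N N' -> ((box n s)%:R : R) <= (box (Num.max N N') s)%:R.
  move=> nN; case: (boolP (box n s)) => //= /allP h.
  suff -> : box (Num.max N N') s by [].
  by apply/allP => x /h /le_trans; apply.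
move=> s sm; apply: (le_trans (ler_normD _ _)); rewrite mulrDl !normrM -!mulrA.
apply: lerD; rewrite ler_wpM2l//.
- by apply: (le_trans (fCN s sm)); rewrite ler_wpM2l// bx// le_max lexx.
- by apply: (le_trans (gCN s sm)); rewrite ler_wpM2l// bx// le_max lexx orbT.
Qed.

Lemma adm_mul m K h f : jmeas m (fun (_ : unit) => h) ->
  (forall s, size s = m -> `|h s| <= K) -> adm m f ->
  adm m (fun s => h s * f s).
Proof.
move=> Jh hK [Jf [C [N [C0 N0 fCN]]]]; split.
  apply: (jmeas_comp2 (g := fun p : mR * mR => p.1 * p.2)) => //.
  exact: measurable_funM.
exists (`|K| * C), N; split=> //; first by rewrite mulr_ge0.
move=> s sm; rewrite normrM -mulrA ler_pM//; last exact: fCN.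
exact: (le_trans (hK s sm) (ler_norm K)).
Qed.

Lemma adm_scale m c f : adm m f -> adm m (fun s => c * f s).
Proof.
move=> af; have := adm_linear c 0 af af.
by under [X in adm m X -> _]eq_fun do rewrite mul0r addr0.
Qed.

Lemma iint_linear m a b f g : adm m f -> adm m g ->
  iint m (fun s => a * f s + b * g s) = a * iint m f + b * iint m g.
Proof.
by move=> af ag; rewrite iintD ?iintZ//; exact: adm_scale.
Qed.

Lemma norm_iint_le m f g : adm m f -> adm m g ->
  (forall s, size s = m -> `|f s| <= g s) -> `|iint m f| <= iint m g.
Proof.
move=> af ag fg; rewrite ler_norml; apply/andP; split.
  rewrite -mulN1r -iintZ//; apply: le_iint => // [|s /fg].
    exact: adm_scale.
  by rewrite mulN1r ler_norml => /andP[].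
by apply: le_iint => // s /fg; rewrite ler_norml => /andP[].
Qed.

Lemma iint0 m : iint m (fun _ : seq R => 0) = 0.
Proof.
elim: m => //= m ->.
by rewrite /Rintegral integral0_eq.
Qed.

Lemma iint_box m (N : R) : 0 <= N ->
  iint m (fun s => (box N s)%:R) = (N *+ 2) ^+ m.
Proof.
move=> N0; elim: m => //= m IH.
rewrite exprSr -(Rintegral_box _ N0); congr Rintegral; apply/funext => t.
by rewrite /box /=; case: (`|t| <= N) => /=; rewrite ?mulr1 ?mulr0 ?iint0.
Qed.

Lemma Rintegral_shift (G : mR -> R) (a : R) : measurable_fun setT G ->
  Rintegral mu setT (fun t => G (t + a)) = Rintegral mu setT G.
Proof.
move=> mG; pose sh := (fun t => t + a) : mR -> mR.
have msh : measurable_fun setT sh by exact: measurable_funD.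
(* Lebesgue measure is determined by its values on half-open intervals, which a translation
   preserves. *)
have muE A : measurable A -> mu A = pushforward mu sh A.
  apply: lebesgue_measure_unique => /= _ [[b c]] _ <-.
  rewrite /pushforward (_ : sh @^-1` _ = `]b - a, c - a]%classic); last first.
    by apply/seteqP; split=> t /=; rewrite !in_itv /= /sh ltrBlDr lerBrDr.
  rewrite [LHS]lebesgue_measure_itv [RHS]lebesgue_measure_itv /= !lte_fin.
  rewrite ltrD2r -!EFinB; case: ifP => // _; congr EFin; ring.
rewrite /Rintegral; congr fine.
have mEG : measurable_fun setT (EFin \o G) by exact/measurable_EFinP.
rewrite [LHS]integralE [RHS]integralE.
have ge0 (g : mR -> \bar R) : measurable_fun setT g -> (forall t, 0 <= g t)%E ->
    (\int[mu]_t g (t + a)%R = \int[mu]_t g t)%E.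
  move=> mg g0; have := ge0_integral_pushforward msh mu measurableT mg (fun t _ => g0 t).
  rewrite preimage_setT => <-.
  by apply: eq_measure_integral => A mA _; exact/esym/muE.
rewrite -(ge0 (EFin \o G)^\+%E) ?funepos_ge0//; last exact: measurable_funepos.
rewrite -(ge0 (EFin \o G)^\-%E) ?funeneg_ge0//; last exact: measurable_funeneg.
by congr (_ - _)%E; apply: eq_integral => t _; rewrite ?funeposE ?funenegE.
Qed.

Fixpoint seq_shift (a : nat -> R) (s : seq R) : seq R :=
  if s is t :: s' then (t + a 0) :: seq_shift (fun i => a i.+1) s' else [::].

Lemma nth_seq_shift a s i : (i < size s)%N ->
  nth 0 (seq_shift a s) i = nth 0 s i + a i.
Proof. by elim: s a i => //= t s IH a [|i] //= /IH ->. Qed.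

Lemma iint_shift m f a : jmeas m (fun (_ : unit) => f) ->
  iint m (fun s => f (seq_shift a s)) = iint m f.
Proof.
elim: m f a => //= m IH f a Jf.
rewrite -(Rintegral_shift (a 0) (measurable_slice Jf)).
congr Rintegral; apply/funext => t.
exact: (IH (fun s => f ((t + a 0) :: s)) _ (jmeas_slice _ Jf)).
Qed.

End iterated_integral.

Arguments jmeas {R} m {d X} F.

(** * Joint measurability of continuous functions *)

Section rows.
Context {R : realType}.
Local Notation mR := (measurableTypeR R).

Lemma rV_norm_le m (x : 'rV[R]_m) (e : R) : 0 <= e ->
  (forall i, `|x 0 i| <= e) -> `|x| <= e.
Proof.
move=> e0 xe; rewrite -[`|x|]/(mx_norm x) mx_normrE; apply: bigmax_le => // -[i j] _ /=.
by rewrite (ord1 i).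
Qed.

Lemma rV_norm_entry m (x : 'rV[R]_m) i : `|x 0 i| <= `|x|.
Proof.
rewrite -[`|x|]/(mx_norm x) mx_normrE.
exact: (le_bigmax _ (fun ij : 'I_1 * 'I_m => `|x ij.1 ij.2|) (0, i)).
Qed.

(** A function of the coordinates that factors through a countably valued map is measurable whatever
    its values: every preimage is a countable union of products. *)
Lemma jmeas_glue m d (X : measurableType d) (q : R -> int)
    (G : X -> seq int -> R) :
  (forall n, measurable (q @^-1` [set n] : set mR)) ->
  (forall z, measurable_fun setT (G ^~ z)) ->
  jmeas m (fun x s => G x (map q s)).
Proof.
move=> mq; elim: m d X G => [|m IH] d X G mG /=; first exact: mG.
apply: (IH _ (X * mR)%type (fun p z => G p.1 (q p.2 :: z))) => z _ Y mY.
rewrite setTI.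
(* The integers are enumerated through [unpickle]; a natural number that encodes nothing contributes
   the empty set. *)
have -> : (fun p : X * mR => G p.1 (q p.2 :: z)) @^-1` Y =
    \bigcup_(k : nat) (if unpickle k is Some n then
      (fst @^-1` ((G ^~ (n :: z)) @^-1` Y)) `&` (snd @^-1` (q @^-1` [set n]))
      else set0).
  apply/seteqP; split => [[x t] /= Yx|[x t] [k _]].
    by exists (pickle (q t)) => //; rewrite pickleK.
  by case: (unpickle k) => // n [/= ?] ->.
apply: bigcupT_measurable => k; case: (unpickle k) => [n|]; last exact: measurable0.
apply: measurableI.
  rewrite -[X in measurable X]setTI; apply: measurable_fst => //.
  by rewrite -[X in measurable X]setTI; exact: mG.
by rewrite -[X in measurable X]setTI; apply: measurable_snd => //; exact: mq.
Qed.

Definition grid_floor (k : nat) (t : R) : int := Num.floor (t * k.+1%:R).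
Definition grid_pt (k : nat) (n : int) : R := n%:~R / k.+1%:R.

Lemma measurable_grid_floor k n :
  measurable (grid_floor k @^-1` [set n] : set mR).
Proof.
rewrite (_ : _ @^-1` _ = `[grid_pt k n, grid_pt k (n + 1)[%classic).
  exact: measurable_itv.
apply/seteqP; split=> t /=; rewrite in_itv /= /grid_pt ler_pdivrMr// ltr_pdivlMr//.
  by move=> /eqP; rewrite /grid_floor floor_eq.
by rewrite -floor_eq => /eqP.
Qed.

Lemma grid_pt_near k t : `|t - grid_pt k (grid_floor k t)| <= k.+1%:R^-1.
Proof.
rewrite /grid_pt /grid_floor; set a : R := k.+1%:R.
have a0 : 0 < a by [].
have /andP[] := floor_itv (t * a).
rewrite intrD => h2 h1.
set n := (_%:~R : R) in h1 h2 *.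
have -> : t - n / a = (t * a - n) * a^-1 by field; exact: lt0r_neq0.
have a1 : 0 <= a^-1 by rewrite invr_ge0 ltW.
rewrite normrM [`|a^-1|]ger0_norm// ler_piMl// ger0_norm; lra.
Qed.

(** The point [y] is replaced by a nearby grid point in [u], but not in the indicator. Grid points
    may leave [O], where [u] is arbitrary; measurability does not suffer, and for [y] in [O]
    continuity at [y] gives the limit. *)
Lemma jmeas_restrict_continuous m (O : set 'rV[R]_m) (u : 'rV[R]_m -> R) :
  jmeas m (fun (_ : unit) s => \1_O (row_of_seq m s) : R) ->
  (forall y, O y -> {for y, continuous u}) ->
  jmeas m (fun (_ : unit) s => \1_O (row_of_seq m s) * u (row_of_seq m s)).
Proof.
move=> JO cu.
pose r k s := row_of_seq m (map (grid_pt k \o grid_floor k) s).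
apply: (@jmeas_cvg _ m _ _ (fun k (_ : unit) s => \1_O (row_of_seq m s) * u (r k s))).
  move=> k; apply: (jmeas_comp2 (g := fun p : mR * mR => p.1 * p.2)) => //.
    exact: measurable_funM.
  have := @jmeas_glue m _ unit (grid_floor k)
    (fun _ z => u (row_of_seq m (map (grid_pt k) z))) (measurable_grid_floor k).
  move=> /(_ (fun _ => measurable_cst _)); apply: eq_jmeas => _ s _.
  by rewrite /r map_comp.
move=> _ s sm; rewrite indicE; case: (boolP (_ \in O)) => [/set_mem Os|_]; last first.
  by rewrite mul0r; under eq_fun do rewrite mul0r; exact: cvg_cst.
rewrite mul1r; under eq_fun do rewrite mul1r.
apply: (@cvg_comp _ _ _ (fun k => r k s) u _ (nbhs (row_of_seq m s))); last exact: cu.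
apply/cvgrPdist_le => e e0.
near=> k.
apply: rV_norm_le => [|i]; first exact: ltW.
rewrite !mxE (nth_map 0) ?sm//; apply: (le_trans (grid_pt_near _ _)).
by apply/ltW; near: k; exact: (near_infty_natSinv_lt (PosNum e0)).
Unshelve. all: by end_near. Qed.

End rows.

Lemma jmeas_cst (R : realType) m d (X : measurableType d) (c : R) :
  jmeas m (fun (_ : X) (_ : seq R) => c).
Proof.
by elim: m d X => [|m IH] d X /=; [exact: measurable_cst|exact: IH].
Qed.

(** * Integrals of functions of row vectors *)

Section row_integral.
Context {R : realType} {m : nat}.
Local Notation mR := (measurableTypeR R).
Local Notation V := 'rV[R]_m.

Definition rint (f : V -> R) : R := iint m (fun s => f (row_of_seq m s)).

Definition rmeas (f : V -> R) : Prop :=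
  jmeas m (fun (_ : unit) s => f (row_of_seq m s)).

Definition radm (f : V -> R) : Prop := adm m (fun s => f (row_of_seq m s)).

Lemma rmeas_continuous (f : V -> R) : continuous f -> rmeas f.
Proof.
move=> cf; have := @jmeas_restrict_continuous R m setT f.
have h1 s : \1_[set: V] (row_of_seq m s) = 1 :> R by rewrite indicT.
move=> H; apply: (@eq_jmeas R m _ unit (fun (_ : unit) s =>
  \1_[set: V] (row_of_seq m s) * f (row_of_seq m s))).
  by move=> _ s _; rewrite h1 mul1r.
apply: H => [|y _]; last exact: cf.
by apply: (@eq_jmeas R m _ unit (fun _ _ => 1)) => //; exact: jmeas_cst.
Qed.

Lemma rmeas_comp2 (g : R -> R -> R) (f1 f2 : V -> R) :
  measurable_fun setT (fun p : mR * mR => (g p.1 p.2 : mR)) ->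
  rmeas f1 -> rmeas f2 -> rmeas (fun y => g (f1 y) (f2 y)).
Proof. by move=> mg J1 J2; exact: (jmeas_comp2 mg J1 J2). Qed.

Lemma rmeas_comp (g : R -> R) (f : V -> R) :
  measurable_fun (setT : set mR) (g : mR -> mR) ->
  rmeas f -> rmeas (fun y => g (f y)).
Proof.
move=> mg J; apply: (rmeas_comp2 (g := fun a _ => g a) _ J J).
exact: measurableT_comp mg _.
Qed.

Lemma size_row_norm_box s N : size s = m -> 0 <= N ->
  (`|row_of_seq m s : V| <= N) = box N s.
Proof.
move=> sm N0; apply/idP/allP => [h t ts|h].
  move: (ts); rewrite -index_mem sm => it.
  have := le_trans (rV_norm_entry (row_of_seq m s) (Ordinal it)) h.
  by rewrite mxE /= nth_index.
by apply: rV_norm_le => // i; rewrite mxE; apply/h/mem_nth; rewrite sm.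
Qed.

Lemma radmP (f : V -> R) C N : rmeas f -> (forall y, `|f y| <= C) ->
  (forall y, N < `|y| -> f y = 0) -> radm f.
Proof.
move=> mf fC fN; split => //.
have C0 : 0 <= C by apply: le_trans (fC 0).
exists C, (Num.max N 0); split=> //; first by rewrite le_max lexx orbT.
move=> s sm; rewrite -size_row_norm_box//; last by rewrite le_max lexx orbT.
case: (leP `|row_of_seq m s : V| _) => [_|]; first by rewrite mulr1.
by rewrite gt_max mulr0 => /andP[/fN -> _]; rewrite normr0.
Qed.

Lemma radm_linear a b (f g : V -> R) : radm f -> radm g ->
  radm (fun y => a * f y + b * g y).
Proof. exact: adm_linear. Qed.

Lemma radm_mul K (h f : V -> R) : rmeas h -> (forall y, `|h y| <= K) ->
  radm f -> radm (fun y => h y * f y).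
Proof. by move=> mh hK; apply: (adm_mul (K := K) mh). Qed.

Lemma rint_linear a b (f g : V -> R) : radm f -> radm g ->
  rint (fun y => a * f y + b * g y) = a * rint f + b * rint g.
Proof. exact: iint_linear. Qed.

Lemma le_rint (f g : V -> R) : radm f -> radm g -> (forall y, f y <= g y) ->
  rint f <= rint g.
Proof. by move=> af ag fg; exact: le_iint. Qed.

Lemma norm_rint_le (f g : V -> R) : radm f -> radm g ->
  (forall y, `|f y| <= g y) -> `|rint f| <= rint g.
Proof. by move=> af ag fg; exact: norm_iint_le. Qed.

Lemma rint0 : rint (fun=> 0) = 0.
Proof. exact: iint0. Qed.

Lemma rint_shift (f : V -> R) (a : V) : rmeas f ->
  rint (fun y => f (y + a)) = rint f.
Proof.
move=> mf; pose b i := if insub i is Some j then a 0 j else 0.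
rewrite /rint -[RHS](iint_shift b mf); apply: eq_iint => s sm; congr f.
apply/rowP => i; rewrite !mxE nth_seq_shift ?sm//; congr (_ + _).
by rewrite /b insubT// => p; congr (a 0 _); apply: val_inj.
Qed.

(** A closed ball of the norm of row vectors, which is the maximum norm. Its integral is known
    exactly, so cubes serve to bound other volumes from above and from below. *)
Definition cube (x : V) (N : R) (y : V) : R := (`|y - x| <= N)%R%:R.

Lemma measurable_bool_le (N : R) :
  measurable_fun (setT : set mR) (fun t : R => (t <= N)%R%:R : mR).
Proof.
rewrite (_ : (fun _ => _) = (\1_(`]-oo, N]) : mR -> R)).
  by apply: measurable_indic; exact: measurable_itv.
by apply/funext => t; rewrite indicE mem_setE in_itv.
Qed.

Lemma rmeas_cube x N : rmeas (cube x N).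
Proof.
apply: (rmeas_comp (g := fun t => (t <= N)%R%:R) (measurable_bool_le N)).
apply: rmeas_continuous => y; apply: (@continuous_comp _ _ _ (fun y : V => y - x) (@Num.norm _ V)).
  by apply: continuousB => //; exact: cst_continuous.
exact: norm_continuous.
Qed.

Lemma radm_cube x N : radm (cube x N).
Proof.
apply: (@radmP _ 1 (N + `|x|) (rmeas_cube x N)).
  by move=> y; rewrite /cube; case: (`|y - x| <= N); rewrite ?normr1 ?normr0.
move=> y h; rewrite /cube; case: leP => // h'.
have := ler_normD (y - x) x; rewrite subrK => h2.
by move: (lt_le_trans h h2); rewrite ltrD2r ltNge h'.
Qed.

Lemma rint_cube x N : 0 <= N -> rint (cube x N) = (N *+ 2) ^+ m.
Proof.
move=> N0; rewrite -(rint_shift x (rmeas_cube x N)) -iint_box//.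
by apply: eq_iint => s sm; rewrite /cube addrK size_row_norm_box.
Qed.

End row_integral.

(** * The Euclidean norm *)

Section enorm_theory.
Context {R : realType} {m : nat}.
Local Notation V := 'rV[R]_m.

Lemma enorm_ge0 (x : V) : 0 <= enorm x.
Proof. exact: sqrtr_ge0. Qed.

Lemma sqr_enorm (x : V) : enorm x ^+ 2 = \sum_(i < m) x 0 i ^+ 2.
Proof. by rewrite sqr_sqrtr// sumr_ge0// => i _; exact: sqr_ge0. Qed.

Lemma enormN (x : V) : enorm (- x) = enorm x.
Proof. by congr Num.sqrt; apply: eq_bigr => i _; rewrite mxE sqrrN. Qed.

Lemma rV_norm_le_enorm (x : V) : `|x| <= enorm x.
Proof.
apply: rV_norm_le => [|i]; first exact: enorm_ge0.
rewrite -(ler_pXn2r (n := 2)) ?nnegrE ?enorm_ge0// sqr_enorm real_normK ?num_real//.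
by rewrite (bigD1 i)//= lerDl sumr_ge0// => j _; exact: sqr_ge0.
Qed.

Lemma continuous_enorm : continuous (@enorm R m).
Proof.
move=> x; apply: (@continuous_comp _ _ _ (fun y : V => \sum_(i < m) y 0 i ^+ 2)
  Num.sqrt); last exact: sqrt_continuous.
apply: (@cvg_big _ _ +%R 0 xpredT (@add_continuous R) _ (nbhs x)) => i _.
apply: (@continuous_comp _ _ _ (fun y : V => y 0 i) (fun t : R => t ^+ 2)).
  exact: coord_continuous.
exact: exprn_continuous.
Qed.

Lemma continuous_enormB (x : V) : continuous (fun y : V => enorm (y - x)).
Proof.
move=> y; apply: (@continuous_comp _ _ _ (fun y : V => y - x) (@enorm R m)).
  by apply: continuousB => //; exact: cst_continuous.
exact: continuous_enorm.
Qed.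

Lemma enorm_delta (i : 'I_m) (r : R) : 0 <= r -> enorm (r *: delta_mx 0 i : V) = r.
Proof.
move=> r0; rewrite /enorm (bigD1 i)//= big1 ?addr0 => [|j ji].
  by rewrite !mxE !eqxx mulr1 sqrtr_sqr ger0_norm.
by rewrite !mxE (negPf ji) mulr0 expr0n.
Qed.

End enorm_theory.

(** * Integrals against radial weights *)

Section radial_integral.
Context {R : realType} {m : nat}.
Local Notation mR := (measurableTypeR R).
Local Notation V := 'rV[R]_m.

Definition rad (phi : R -> R) (x : V) (w : V -> R) : R :=
  rint (fun y => phi (enorm (y - x)) * w y).

(** An interval of radii covers annuli, half-open rings and balls alike; since [enorm] is
    nonnegative, []-oo, r[] gives the open ball. *)
Definition shell (i : interval R) (x : V) (w : V -> R) : R :=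
  rad (fun t => (t \in i)%:R) x w.

Lemma rmeas_radial (phi : R -> R) x :
  measurable_fun (setT : set mR) (phi : mR -> mR) ->
  rmeas (fun y : V => phi (enorm (y - x))).
Proof.
by move=> mphi; apply: (rmeas_comp mphi); exact/rmeas_continuous/continuous_enormB.
Qed.

Lemma measurable_mem_itv (i : interval R) :
  measurable_fun (setT : set mR) (fun t : R => (t \in i)%:R : mR).
Proof.
rewrite (_ : (fun _ => _) = (\1_([set` i]) : mR -> R)).
  by apply: measurable_indic; exact: measurable_itv.
by apply/funext => t; rewrite indicE mem_setE.
Qed.

(** Nothing is asked of [w] off the open maximum-norm ball; the bound makes the cut-off function
    integrable. *)
Definition bcont (x0 : V) (eta M : R) (w : V -> R) : Prop :=
  forall y, `|y - x0| < eta -> {for y, continuous w} /\ `|w y| <= M.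

Lemma bcont_cst x0 eta (c : R) : bcont x0 eta `|c| (fun=> c).
Proof. by move=> y _; split=> //; exact: cst_continuous. Qed.

Lemma radm_restrict x0 eta M w : bcont x0 eta M w ->
  radm (fun y => (`|y - x0| < eta)%R%:R * w y).
Proof.
move=> bw; pose O : set V := [set y | `|y - x0| < eta].
have OE y : (`|y - x0| < eta)%R%:R = \1_O y :> R.
  rewrite indicE; congr (_%:R); congr nat_of_bool.
  by apply/idP/idP => [h|/set_mem//]; rewrite inE.
have mO : rmeas (fun y : V => (`|y - x0| < eta)%R%:R : R).
  have mI := measurable_mem_itv `]-oo, eta[.
  have cN : continuous (fun y : V => `|y - x0|).
    move=> y; apply: (@continuous_comp _ _ _ (fun y : V => y - x0) (@Num.norm _ V)).
      by apply: continuousB => //; exact: cst_continuous.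
    exact: norm_continuous.
  have := rmeas_comp mI (rmeas_continuous cN).
  by apply: eq_jmeas => _ s _; rewrite in_itv.
have mw : rmeas (fun y => (`|y - x0| < eta)%R%:R * w y).
  have := @jmeas_restrict_continuous R m O w.
  move=> H; apply: (@eq_jmeas R m _ unit (fun (_ : unit) s =>
    \1_O (row_of_seq m s) * w (row_of_seq m s))).
    by move=> _ s _; rewrite OE.
  apply: H => [|y /bw[]//].
  by apply: (eq_jmeas _ mO) => _ s _; rewrite OE.
apply: (@radmP _ _ _ (Num.max M 0) (`|x0| + eta) mw) => y.
  case: (ltP `|y - x0| eta) => [/bw[_ wM]|_].
    by rewrite mul1r le_max wM.
  by rewrite mul0r normr0 le_max lexx orbT.
move=> h; case: ltP => [h'|_]; last by rewrite mul0r.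
have := ler_normD (y - x0) x0; rewrite subrK => h2.
by have := lt_le_trans h h2; rewrite addrC ltrD2r => /(lt_trans h'); rewrite ltxx.
Qed.

Variables (x0 : V) (eta : R).

Definition inside (x : V) (rho : R) : Prop :=
  forall y, enorm (y - x) <= rho -> `|y - x0| < eta.

(** Since [phi] vanishes beyond [rho], the cutoff to the neighbourhood of [x0] can be inserted
    without changing the integrand. *)
Lemma radm_radial phi K M x rho w :
  measurable_fun (setT : set mR) (phi : mR -> mR) ->
  (forall t, `|phi t| <= K) -> (forall t, rho < t -> phi t = 0) ->
  inside x rho -> bcont x0 eta M w ->
  radm (fun y => phi (enorm (y - x)) * w y).
Proof.
move=> mphi phiK phi0 ix /radm_restrict rw.
have := radm_mul (rmeas_radial x mphi) (fun y => phiK _) rw.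
rewrite (_ : (fun y => _) = (fun y => phi (enorm (y - x)) * w y))//.
apply/funext => y; case: (leP (enorm (y - x)) rho) => [/ix ->|/phi0 ->].
  by rewrite mul1r.
by rewrite !mul0r.
Qed.

Lemma radm_shell M x rho w (i : interval R) :
  (forall t, t \in i -> t <= rho) ->
  inside x rho -> bcont x0 eta M w ->
  radm (fun y => (enorm (y - x) \in i)%:R * w y).
Proof.
move=> irho ix bw; apply: (radm_radial (K := 1) (measurable_mem_itv i) _ _ ix bw).
  by move=> t; case: (t \in i); rewrite ?normr1 ?normr0.
by move=> t; rewrite ltNge; apply: contraNeq; case: (boolP (t \in i)) => [/irho//|]; rewrite eqxx.
Qed.

Lemma shell_add M x rho w (i j k : interval R) :
  (forall t, t \in k -> t <= rho) ->
  (forall t, (t \in k)%:R = (t \in i)%:R + (t \in j)%:R :> R) ->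
  inside x rho -> bcont x0 eta M w ->
  shell k x w = shell i x w + shell j x w.
Proof.
move=> krho kij ix bw.
have ik t : t \in i -> t <= rho.
  by move=> ti; apply: krho; have := kij t; rewrite ti; case: (t \in k) => // /eqP;
    rewrite eq_sym paddr_eq0// oner_eq0.
have jk t : t \in j -> t <= rho.
  by move=> ti; apply: krho; have := kij t; rewrite ti; case: (t \in k) => // /eqP;
    rewrite eq_sym paddr_eq0// oner_eq0 andbF.
rewrite /shell /rad -[X in X + _]mul1r -[X in _ + X]mul1r -rint_linear.
- by congr rint; apply/funext => y; rewrite kij mulrDl !mul1r.
- exact: radm_shell ik ix bw.
- exact: radm_shell jk ix bw.
Qed.

Lemma shell_ann_gt0 x rho (r1 r2 : R) (i : interval R) : (0 < m)%N ->
  0 <= r1 < r2 -> (forall t, t \in i -> t <= rho) ->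
  (forall t, r1 < t < r2 -> t \in i) ->
  inside x rho -> 0 < shell i x (fun=> 1).
Proof.
move=> m0 /andP[r10 r12] irho ri ix.
(* A point at the middle radius: a small cube around it lies in the annulus and has positive
   volume. *)
pose p : V := x + ((r1 + r2) / 2) *: delta_mx 0 (Ordinal m0).
have pE : enorm (p - x) = (r1 + r2) / 2.
  by rewrite /p [x + _]addrC addrK enorm_delta//; lra.
have : \forall y \near p, r1 < enorm (y - x) < r2.
  have c := @continuous_enormB R m x p.
  have : \forall t \near enorm (p - x), r1 < t < r2.
    have : nbhs (enorm (p - x)) `]r1, r2[%classic.
      by apply: near_in_itvoo; rewrite in_itv /= pE; apply/andP; split; lra.
    by apply: filterS => t /=; rewrite in_itv.
  exact: c.
move=> /nbhs_ballP[d /= d0 dp].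
have d20 : 0 <= d / 2 by rewrite divr_ge0// ltW.
apply: (@lt_le_trans _ _ (rint (cube p (d / 2)))).
  rewrite rint_cube// exprn_gt0// pmulrn_lgt0//; lra.
apply: le_rint; first exact: radm_cube.
  have := radm_shell irho ix (@bcont_cst x0 eta 1).
  exact.
move=> y; rewrite mulr1 /cube; case: (leP `|y - p| (d / 2)) => // yp.
rewrite ri//; apply: dp; rewrite mx_norm_ball /ball_ /= distrC.
by apply: (le_lt_trans yp); lra.
Qed.

End radial_integral.

(** * From annuli to the mean value property on balls *)

Section mean_value.
Context {R : realType} {m : nat}.
Local Notation mR := (measurableTypeR R).
Local Notation V := 'rV[R]_m.
Hypothesis m_gt0 : (0 < m)%N.
Variables (x0 x : V) (eta M rho : R) (u : V -> R).
Hypothesis rho_gt0 : 0 < rho.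
Hypothesis x_inside : inside x0 eta x rho.
Hypothesis bu : bcont x0 eta M u.

Let b1 := @bcont_cst R m x0 eta 1.

(** On a shell of positive volume, [a] is the mean of [u] exactly when this difference vanishes.
    Unlike a mean it is additive in the shell, so subtracting annuli is cancellation. *)
Let shell_lin a (i j k : interval R) :
  (forall t, t \in k -> t <= rho) ->
  (forall t, (t \in k)%:R = (t \in i)%:R + (t \in j)%:R :> R) ->
  shell k x u - a * shell k x (fun=> 1)
  = (shell i x u - a * shell i x (fun=> 1))
  + (shell j x u - a * shell j x (fun=> 1)).
Proof.
move=> krho kij.
rewrite (shell_add krho kij x_inside bu) (shell_add krho kij x_inside b1); ring.
Qed.

Let annulus_gt0 (r1 r2 : R) (i : interval R) : 0 <= r1 < r2 ->
  (forall t, t \in i -> t <= rho) -> (forall t, r1 < t < r2 -> t \in i) ->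
  0 < shell i x (fun=> 1).
Proof. by move=> r12 irho ri; exact: shell_ann_gt0 r12 irho ri x_inside. Qed.

Lemma annulus_mean_const (K : R -> R) :
  [\/ forall r1 r2 : R, 0 < r1 -> r1 < r2 -> r2 <= rho -> forall r : R, r1 < r < r2 ->
        shell `]r1, r2[ x u / shell `]r1, r2[ x (fun=> 1) = K r,
      forall r1 r2 : R, 0 < r1 -> r1 < r2 -> r2 <= rho ->
        shell `]r1, r2[ x u / shell `]r1, r2[ x (fun=> 1) = K r1 |
      forall r1 r2 : R, 0 < r1 -> r1 < r2 -> r2 <= rho ->
        shell `]r1, r2[ x u / shell `]r1, r2[ x (fun=> 1) = K r2] ->
  exists c, forall r1 r2 : R, 0 < r1 -> r1 < r2 -> r2 <= rho ->
    shell `]r1, r2[ x u - c * shell `]r1, r2[ x (fun=> 1) = 0.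
Proof.
have oo (r1 r2 : R) : 0 < r1 -> r1 < r2 -> r2 <= rho ->
    0 < shell `]r1, r2[ x (fun=> 1).
  move=> r10 r12 r2rho; apply: (annulus_gt0 (r1 := r1) (r2 := r2)) => [|t|t].
  - lra.
  - by rewrite in_itv /=; lra.
  - by rewrite in_itv.
have div (a r1 r2 : R) : 0 < r1 -> r1 < r2 -> r2 <= rho ->
    shell `]r1, r2[ x u / shell `]r1, r2[ x (fun=> 1) = a ->
    shell `]r1, r2[ x u - a * shell `]r1, r2[ x (fun=> 1) = 0.
  move=> r10 r12 r2rho <-; rewrite divfK ?subrr//.
  exact: lt0r_neq0 (oo _ _ r10 r12 r2rho).
have uniq (a b : R) (i : interval R) : 0 < shell i x (fun=> 1) ->
    shell i x u - a * shell i x (fun=> 1) = 0 ->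
    shell i x u - b * shell i x (fun=> 1) = 0 -> a = b.
  move=> i0 /subr0_eq -> /subr0_eq.
  by apply: mulIf; exact: lt0r_neq0.
case=> H.
(* Both radii lie strictly inside the single annulus []a / 2, rho[]. *)
- have Kc (a b : R) : 0 < a -> a < b -> b < rho -> K a = K b.
    move=> a0 ab brho; rewrite -(H (a / 2) rho _ _ _ a) ?(H (a / 2) rho _ _ _ b)//; lra.
  exists (K (rho / 2)) => r1 r2 r10 r12 r2rho; apply: div => //.
  rewrite (H _ _ _ _ _ ((r1 + r2) / 2))//; last lra.
  by case: (ltgtP ((r1 + r2) / 2) (rho / 2)) => [h|h|->//]; [|symmetry]; apply: Kc => //; lra.
(* Prescribed inner radius [c]: the annuli []c, rho[] and []c, r2[] both have mean [K c], hence so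
   has [[r2, rho[], which is the same ring for [c = a] and [c = b] as soon as [r2 > b]. *)
- have Kc (a b : R) : 0 < a -> a < b -> b < rho -> K a = K b.
    move=> a0 ab brho; pose r2 : R := (b + rho) / 2.
    have br2 : b < r2 by rewrite /r2; lra.
    have r2rho : r2 < rho by rewrite /r2; lra.
    move: r2 br2 r2rho => r2 br2 r2rho.
    have ring_eq (c : R) : 0 < c -> c < r2 ->
        shell `[r2, rho[ x u - K c * shell `[r2, rho[ x (fun=> 1) = 0.
      move=> c0 cr2; have := @shell_lin (K c) `]c, r2[ `[r2, rho[ `]c, rho[.
      rewrite (div (K c) c rho)//; [|lra|by apply: H => //; lra].
      rewrite (div (K c) c r2)//; [|lra|by apply: H => //; lra].
      rewrite add0r => <- // t; first by rewrite in_itv /=; lra.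
      rewrite !in_itv /=.
      by case: (ltP c t); case: (ltP t r2); case: (ltP t rho) => * /=;
        rewrite ?mulr0n ?mulr1n; lra.
    apply: (uniq _ _ `[r2, rho[); [|apply: ring_eq; lra..].
    apply: (annulus_gt0 (r1 := r2) (r2 := rho)) => [|t|t]; rewrite ?in_itv /=; lra.
  exists (K (rho / 2)) => r1 r2 r10 r12 r2rho; apply: div => //.
  rewrite H//.
  by case: (ltgtP r1 (rho / 2)) => [h|h|->//]; [|symmetry]; apply: Kc => //; lra.
(* Prescribed outer radius [c]: now []a / 4, c[] and []a / 2, c[] differ by the ring []a / 4, a /
   2]], common to all [c >= a]. *)
- have Kc (a b : R) : 0 < a -> a < b -> b <= rho -> K a = K b.
    move=> a0 ab brho; pose i := `]a / 4, a / 2] : interval R.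
    have ring_eq (c : R) : a <= c -> c <= rho ->
        shell i x u - K c * shell i x (fun=> 1) = 0.
      move=> ac crho; have := @shell_lin (K c) i `]a / 2, c[ `]a / 4, c[.
      rewrite (div (K c) (a / 4) c)//; [|lra|lra|by apply: H => //; lra].
      rewrite (div (K c) (a / 2) c)//; [|lra|lra|by apply: H => //; lra].
      rewrite addr0 => <- // t; first by rewrite in_itv /=; lra.
      rewrite /i !in_itv /=.
      by case: (ltP (a / 4) t); case: (leP t (a / 2)); case: (ltP (a / 2) t); case: (ltP t c) => * /=;
        rewrite ?mulr0n ?mulr1n; lra.
    apply: (uniq _ _ i); [|apply: ring_eq; lra..].
    apply: (annulus_gt0 (r1 := a / 4) (r2 := a / 2)) => [|t|t]; rewrite /i ?in_itv /=; lra.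
  (* The outer radius may equal [rho], so constancy was needed up to [rho] included. *)
  exists (K rho) => r1 r2 r10 r12 r2rho; apply: div => //; rewrite H//.
  by move: r2rho; rewrite le_eqVlt => /predU1P[->//|h]; apply: Kc => //; lra.
Qed.

Lemma norm_shell_le (i : interval R) (w : V -> R) (C : R) :
  (forall t, t \in i -> t <= rho) ->
  (forall y, enorm (y - x) \in i -> `|w y| <= C) ->
  radm (fun y => (enorm (y - x) \in i)%:R * w y) ->
  `|shell i x w| <= C * shell i x (fun=> 1).
Proof.
move=> irho wC aw.
have ai := radm_shell irho x_inside b1.
(* The zero second term puts a scalar multiple in the form of [rint_linear]. *)
have -> : C * shell i x (fun=> 1) =
    rint (fun y => C * ((enorm (y - x) \in i)%:R * 1) + 0 * ((enorm (y - x) \in i)%:R * 1)).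
  by rewrite rint_linear// mul0r addr0.
apply: norm_rint_le => //; first exact: radm_linear.
move=> y; rewrite mul0r addr0 mulr1 normrM.
case: (boolP (_ \in i)) => [/wC h|_]; first by rewrite normr1 mul1r mulr1.
by rewrite normr0 mul0r mulr0.
Qed.

Lemma ball_mean_const c :
  (forall r1 r2 : R, 0 < r1 -> r1 < r2 -> r2 <= rho ->
    shell `]r1, r2[ x u - c * shell `]r1, r2[ x (fun=> 1) = 0) ->
  forall r : R, 0 < r -> r <= rho ->
    shell `]-oo, r[ x u - c * shell `]-oo, r[ x (fun=> 1) = 0.
Proof.
move=> H r r0 rrho; set X := (X in X = 0).
(* The annulus []r1, r[] contributes nothing, so [X] comes from the ball of radius [r1]. That ball
   lies in a cube of volume [(2 * r1) ^+ m], at most [2 * r1] because [r1 <= 1 / 2]. *)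
have small (r1 : R) : 0 < r1 -> r1 < r -> r1 <= 1 / 2 -> `|X| <= ((M + `|c|) * 2) * r1.
  move=> r10 r1r r1h.
  have i1rho t : t \in `]-oo, r1] -> t <= rho by rewrite in_itv /=; lra.
  have -> : X = shell `]-oo, r1] x u - c * shell `]-oo, r1] x (fun=> 1).
    rewrite /X (@shell_lin c `]-oo, r1] `]r1, r[) ?H ?addr0//.
      by move=> t; rewrite in_itv /=; lra.
    move=> t; rewrite !in_itv /=.
    by case: (leP t r1); case: (ltP r1 t); case: (ltP t r) => * /=;
      rewrite ?mulr0n ?mulr1n; lra.
  have V1 : shell `]-oo, r1] x (fun=> 1) <= r1 *+ 2.
    apply: (@le_trans _ _ (rint (cube x r1))).
      apply: le_rint; [exact: (radm_shell i1rho x_inside b1)|exact: radm_cube|].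
      move=> y; rewrite mulr1 in_itv /= /cube.
      case: (leP (enorm (y - x)) r1) => // h.
      by rewrite (le_trans (rV_norm_le_enorm _) h).
    rewrite rint_cube; last exact: ltW.
    by rewrite ler_iXnr// mulr2n; lra.
  have V0 : 0 <= shell `]-oo, r1] x (fun=> 1).
    by apply: ltW; apply: (annulus_gt0 (r1 := 0) (r2 := r1)) => // [|t]; rewrite ?in_itv /=; lra.
  have hM : `|shell `]-oo, r1] x u| <= M * shell `]-oo, r1] x (fun=> 1).
    apply: norm_shell_le => //; last exact: radm_shell i1rho x_inside bu.
    by move=> y /i1rho /x_inside /bu[].
  have M0 : 0 <= M + `|c|.
    rewrite addr_ge0//; apply: (@le_trans _ _ `|u x|) => //.
    have [|_ //] := bu (y := x); apply: x_inside; rewrite subrr.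
    have -> : enorm (0 : V) = 0; last exact: ltW.
    by rewrite /enorm big1 ?sqrtr0// => i _; rewrite mxE expr0n.
  apply: (le_trans (ler_normB _ _)); rewrite normrM [`|shell _ _ (fun=> 1)|]ger0_norm//.
  apply: (@le_trans _ _ ((M + `|c|) * shell `]-oo, r1] x (fun=> 1))).
    by rewrite mulrDl lerD2r.
  by rewrite -mulrA ler_wpM2l// mulr_natl.
apply/eqP; rewrite -normr_eq0; apply/eqP/le_anti; rewrite normr_ge0 andbT.
apply/ler_addgt0Pr => e e0; rewrite add0r.
set C := (M + `|c|) * 2 in small.
(* Adding [1] keeps the denominator positive even if [C] is zero. *)
pose r1 := Num.min (Num.min (r / 2) (1 / 2)) (e / (`|C| + 1)).
have C1 : 0 < `|C| + 1 by rewrite ltr_wpDl.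
have r10 : 0 < r1 by rewrite !lt_min !divr_gt0.
apply: (le_trans (small r1 r10 _ _)).
- by rewrite /r1 !gt_min; have -> : r / 2 < r by lra.
- by rewrite /r1 !ge_min lexx orbT.
apply: (@le_trans _ _ ((`|C| + 1) * (e / (`|C| + 1)))); last first.
  by rewrite mulrCA divff ?mulr1// lt0r_neq0.
apply: (@le_trans _ _ ((`|C| + 1) * r1)).
  by rewrite ler_pM2r//; have := ler_norm C; lra.
by rewrite ler_pM2l// /r1 ge_min lexx orbT.
Qed.

(** On a small ball [u] stays within [e] of [u x], and so does its mean, which is [c] at every
    radius. *)
Lemma ball_mean_value c :
  (forall r : R, 0 < r -> r <= rho ->
    shell `]-oo, r[ x u - c * shell `]-oo, r[ x (fun=> 1) = 0) ->
  c = u x.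
Proof.
move=> H; apply/eqP; rewrite -subr_eq0 -normr_eq0; apply/eqP/le_anti.
rewrite normr_ge0 andbT; apply/ler_addgt0Pr => e e0; rewrite add0r.
have xx : `|x - x0| < eta.
  apply: x_inside; rewrite subrr; have -> : enorm (0 : V) = 0; last exact: ltW.
  by rewrite /enorm big1 ?sqrtr0// => i _; rewrite mxE expr0n.
have [cu _] := bu xx.
have /nbhs_ballP[d /= d0 du] : \forall y \near x, `|u x - u y| < e.
  by move: cu => /cvgrPdist_lt; exact.
pose r := Num.min d rho.
have r0 : 0 < r by rewrite lt_min d0.
have rrho : r <= rho by rewrite ge_min lexx orbT.
have irho t : t \in `]-oo, r[ -> t <= rho by rewrite in_itv /=; lra.
have V0 : 0 < shell `]-oo, r[ x (fun=> 1).
  by apply: (annulus_gt0 (r1 := 0) (r2 := r)) => // [|t]; rewrite ?in_itv /=; lra.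
have au := radm_shell irho x_inside bu.
have a1 := radm_shell irho x_inside b1.
have wE : (fun y => (enorm (y - x) \in `]-oo, r[)%:R * (u y - u x))
  = (fun y => 1 * ((enorm (y - x) \in `]-oo, r[)%:R * u y) +
       (- u x) * ((enorm (y - x) \in `]-oo, r[)%:R * 1)).
  by apply/funext => y; ring.
have : `|shell `]-oo, r[ x (fun y => u y - u x)| <= e * shell `]-oo, r[ x (fun=> 1).
  apply: norm_shell_le => //; last by rewrite wE; exact: radm_linear.
  move=> y; rewrite in_itv /= => yr; rewrite distrC; apply/ltW/du.
  rewrite mx_norm_ball /ball_ /= distrC; apply: (le_lt_trans (rV_norm_le_enorm _)).
  by apply: (lt_le_trans yr); rewrite ge_min lexx.
have -> : shell `]-oo, r[ x (fun y => u y - u x) =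
    (c - u x) * shell `]-oo, r[ x (fun=> 1).
  transitivity (1 * shell `]-oo, r[ x u + - u x * shell `]-oo, r[ x (fun=> 1)).
    by rewrite /shell /rad wE; exact: rint_linear.
  by move/subr0_eq: (H r r0 rrho) => ->; ring.
by rewrite normrM (ger0_norm (ltW V0)) ler_pM2r.
Qed.

End mean_value.

(** * The truncated paraboloid *)

Section bump_profile.
Context {R : realType}.
Local Notation mR := (measurableTypeR R).

Definition tau (rho t : R) : R := Num.max (rho ^+ 2 - t ^+ 2) 0.

Lemma tau_ge0 rho t : 0 <= tau rho t.
Proof. by rewrite /tau le_max lexx orbT. Qed.

Lemma tau_le rho t : tau rho t <= rho ^+ 2.
Proof. by rewrite /tau ge_max sqr_ge0 andbT gerBl sqr_ge0. Qed.

Lemma norm_tauX_le rho t k : `|tau rho t ^+ k| <= (rho ^+ 2) ^+ k.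
Proof.
rewrite ger0_norm; last by rewrite exprn_ge0// tau_ge0.
by apply: lerXn2r; rewrite ?nnegrE ?tau_ge0 ?sqr_ge0 ?tau_le.
Qed.

Lemma tau_out rho t : 0 <= rho -> rho <= t -> tau rho t = 0.
Proof. by move=> r0 rt; rewrite /tau max_r// subr_le0 ler_pXn2r ?nnegrE //; lra. Qed.

Lemma measurable_tauX rho k :
  measurable_fun (setT : set mR) (fun t : R => tau rho t ^+ k : mR).
Proof.
apply: measurable_funX; apply: measurable_maxr => //.
by apply: measurable_funB => //; exact: measurable_funX.
Qed.

Lemma tauX_lipschitz rho k : 0 < rho -> exists2 L, 0 <= L &
  forall s t, 0 <= s <= rho -> 0 <= t <= rho ->
    `|tau rho s ^+ k - tau rho t ^+ k| <= L * `|s - t|.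
Proof.
move=> r0; elim: k => [|k [L L0 IH]].
  by exists 0 => // s t _ _; rewrite subrr normr0 mul0r.
(* Product rule for differences: [rho ^+ 2] bounds [tau], and [rho *+ 2] bounds the factor [s + t]
   of [t ^+ 2 - s ^+ 2]. *)
exists (rho ^+ 2 * L + (rho ^+ 2) ^+ k * (rho *+ 2)).
  by rewrite addr_ge0// !mulr_ge0// ?exprn_ge0// ?mulrn_wge0 ?ltW// sqr_ge0.
move=> s t sr tr.
have -> : tau rho s ^+ k.+1 - tau rho t ^+ k.+1 =
   tau rho s * (tau rho s ^+ k - tau rho t ^+ k) +
   tau rho t ^+ k * (tau rho s - tau rho t) by rewrite !exprS; ring.
apply: (le_trans (ler_normD _ _)); rewrite !normrM mulrDl.
rewrite -(mulrA (rho ^+ 2) L) -(mulrA ((rho ^+ 2) ^+ k)).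
apply: lerD; apply: ler_pM => //.
- by rewrite ger0_norm ?tau_ge0// tau_le.
- exact: IH.
- exact: norm_tauX_le.
have tauE r : 0 <= r <= rho -> tau rho r = rho ^+ 2 - r ^+ 2.
  by move=> rr; rewrite /tau max_l// subr_ge0 ler_pXn2r ?nnegrE //; lra.
rewrite !tauE// (_ : _ - _ = (s + t) * (t - s)); last by ring.
rewrite normrM [`|t - s|]distrC mulr2n; apply: ler_wpM2r => //.
by rewrite ger0_norm; lra.
Qed.

End bump_profile.

(** * From balls to smooth radial weights *)

Section profile_mean_value.
Context {R : realType} {m : nat}.
Local Notation mR := (measurableTypeR R).
Local Notation V := 'rV[R]_m.
Variables (x0 x : V) (eta M rho : R) (w : V -> R).
Hypothesis rho_gt0 : 0 < rho.
Hypothesis x_inside : inside x0 eta x rho.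
Hypothesis bw : bcont x0 eta M w.
Hypothesis ball0 : forall r : R, 0 < r -> r <= rho -> shell `]-oo, r[ x w = 0.

(** Abel summation: for nondecreasing radii and [t] in [[r i, r i.+1[], the terms [j >= i] telescope
    to [phi (r i) - phi (r n)]. Only indicators of balls occur, the sets over which the integral of
    [w] is known to vanish. *)
Definition step (phi : R -> R) (r : nat -> R) (n : nat) (t : R) : R :=
  \sum_(j < n) (phi (r j) - phi (r j.+1)) * (t \in `]-oo, r j.+1[)%:R.

Lemma step_mean (phi : R -> R) (r : nat -> R) n :
  (forall j, (j < n)%N -> 0 < r j.+1 <= rho) ->
  radm (fun y => step phi r n (enorm (y - x)) * w y) /\
  rad (step phi r n) x w = 0.
Proof.
elim: n => [|n IH] hr.
  have e0 : (fun y => step phi r 0 (enorm (y - x)) * w y) = fun=> 0.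
    by apply/funext => y; rewrite /step big_ord0 mul0r.
  rewrite /rad e0 rint0; split=> //.
  apply: (@radmP _ _ _ 0 0) => [|y|//]; last by rewrite normr0.
  exact: jmeas_cst.
have [|an Dn] := IH; first by move=> j jn; apply: hr; rewrite ltnS ltnW.
have /andP[rn0 rnr] := hr n (ltnSn n).
have irho t : t \in `]-oo, r n.+1[ -> t <= rho by rewrite in_itv /=; lra.
have ai := radm_shell irho x_inside bw.
have e1 : (fun y => step phi r n.+1 (enorm (y - x)) * w y) =
    (fun y => 1 * (step phi r n (enorm (y - x)) * w y) +
      (phi (r n) - phi (r n.+1)) * ((enorm (y - x) \in `]-oo, r n.+1[)%:R * w y)).
  by apply/funext => y; rewrite {1}/step big_ord_recr /= mul1r mulrDl mulrA.
rewrite /rad e1; split; first exact: radm_linear.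
rewrite rint_linear// -/(rad (step phi r n) x w) Dn mulr0 add0r.
by rewrite (_ : rint _ = 0) ?mulr0//; exact: ball0.
Qed.

Lemma step_approx (phi : R -> R) (r : nat -> R) (e : R) n : r 0 = 0 ->
  (forall j, (j < n)%N -> r j <= r j.+1) ->
  (forall j t, (j < n)%N -> r j <= t -> t < r j.+1 -> `|phi (r j) - phi t| <= e) ->
  forall t, 0 <= t ->
  (t < r n -> `|step phi r n t - (phi t - phi (r n))| <= e) /\
  (r n <= t -> step phi r n t = 0).
Proof.
move=> r0; elim: n => [|n IH] rS hphi t t0.
  by rewrite r0 /step big_ord0; split=> //; lra.
have [||IH1 IH2] := IH _ _ t t0.
- by move=> j jn; apply: rS; rewrite ltnS ltnW.
- by move=> j s jn; apply: hphi; rewrite ltnS ltnW.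
have rn := rS n (ltnSn n).
have -> : step phi r n.+1 t =
    step phi r n t + (phi (r n) - phi (r n.+1)) * (t < r n.+1)%R%:R.
  by rewrite /step big_ord_recr /= in_itv.
split=> h; last by rewrite IH2 ?add0r ?ltNge ?h ?mulr0//; lra.
rewrite h mulr1; have [tn|tn] := ltP t (r n).
  rewrite (_ : _ - _ = step phi r n t - (phi t - phi (r n))); first exact: IH1.
  by ring.
rewrite IH2// (_ : _ - _ = phi (r n) - phi t); last by ring.
exact: hphi.
Qed.

(** A positive exponent makes the profile vanish from [rho] on, which removes the offset [phi (r n)]
    left by the step approximation. *)
Lemma tauX_mean k : (0 < k)%N -> rad (fun t => tau rho t ^+ k) x w = 0.
Proof.
move=> k0; set phi := fun t => _.
have [L L0 phiL] := tauX_lipschitz k rho_gt0.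
have rho0 := ltW rho_gt0.
have phi_out t : rho <= t -> phi t = 0.
  by move=> rt; rewrite /phi tau_out// expr0n eqn0Ngt k0.
have irho (t : R) : t \in `]-oo, rho[ -> t <= rho by rewrite in_itv /=; lra.
have b1 := @bcont_cst R m x0 eta 1.
have aphi : radm (fun y => phi (enorm (y - x)) * w y).
  apply: (radm_radial (K := (rho ^+ 2) ^+ k) (measurable_tauX rho k) _ _ x_inside bw).
    by move=> t; exact: norm_tauX_le.
  by move=> t rt; apply: phi_out; lra.
set Vol := shell `]-oo, rho[ x (fun=> 1).
have Vol0 : 0 <= Vol.
  rewrite -(@rint0 R m); apply: le_rint; last by move=> y; rewrite mulr1.
    by apply: (@radmP _ _ _ 0 0) => [|y|//]; [exact: jmeas_cst|rewrite normr0].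
  exact: radm_shell irho x_inside b1.
pose C := L * rho * `|M| * Vol.
have C0 : 0 <= C by rewrite !mulr_ge0.
(* With [N.+1] equal steps of length [rho / N.+1], the Lipschitz constant [L] bounds the error of
   the step function, whose own integral against [w] is zero. *)
have bound (N : nat) : `|rad phi x w| <= C * N.+1%:R^-1.
  pose r (j : nat) := rho * (j%:R / N.+1%:R).
  have N0 : 0 < N.+1%:R :> R by [].
  have rN : r N.+1 = rho by rewrite /r divff ?mulr1// lt0r_neq0.
  have rS j : r j <= r j.+1.
    by rewrite /r ler_pM2l// ler_pM2r ?invr_gt0// ler_nat.
  have rSd j : r j.+1 - r j = rho * N.+1%:R^-1.
    by rewrite /r -natr1; field; exact: lt0r_neq0.
  have r00 : r 0%N = 0 by rewrite /r mul0r mulr0.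
  have r_ge0 j : 0 <= r j by rewrite /r mulr_ge0// divr_ge0.
  have r_le j : (j <= N.+1)%N -> r j <= rho.
    by move=> jN; rewrite -[X in _ <= X]rN /r ler_pM2l// ler_pM2r ?invr_gt0// ler_nat.
  have [|aS DS] := @step_mean phi r N.+1.
    move=> j jN; rewrite r_le// andbT /r mulr_gt0// divr_gt0//.
  pose e := L * (rho * N.+1%:R^-1).
  have apx := @step_approx phi r e N.+1 r00 (fun j _ => rS j).
  have E : rad phi x w = rint (fun y => 1 * (phi (enorm (y - x)) * w y) +
      (- 1) * (step phi r N.+1 (enorm (y - x)) * w y)).
    by rewrite rint_linear// -/(rad (step _ _ _) x w) DS mulr0 addr0 mul1r.
  rewrite E; have -> : C * N.+1%:R^-1 = rint (fun y =>
      (e * `|M|) * ((enorm (y - x) \in `]-oo, rho[)%:R * 1) +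
      0 * ((enorm (y - x) \in `]-oo, rho[)%:R * 1)).
    have ai := radm_shell irho x_inside b1.
    rewrite rint_linear// mul0r addr0 -/(rad _ x (fun=> 1)) -/Vol /C /e.
    by rewrite (_ : rint _ = Vol)//; ring.
  apply: norm_rint_le.
  - exact: radm_linear.
  - by apply: radm_linear; exact: radm_shell irho x_inside b1.
  move=> y; set t := enorm (y - x).
  have t0 : 0 <= t by exact: enorm_ge0.
  rewrite mul0r addr0 mulr1 mul1r mulN1r -mulrBl normrM in_itv /=.
  have {}apx := apx _ t t0; rewrite rN in apx.
  have [|apx1 apx2] := apx.
    move=> j s jN rs sr; apply: (le_trans (phiL _ _ _ _)).
    - by rewrite r_ge0 r_le// ltnW.
    - by have := r_ge0 j; have := r_le j.+1 jN; lra.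
    rewrite /e ler_wpM2l// -(rSd j) distrC ger0_norm; lra.
  case: (ltP t rho) => h; last first.
    by rewrite mulr0 phi_out// apx2// subrr normr0 mul0r.
  rewrite mulr1; apply: ler_pM => //.
    by have := apx1 h; rewrite (phi_out rho)// subr0 distrC.
  have [|_ wM] := bw (y := y); first by apply: x_inside; exact: ltW.
  exact: le_trans wM (ler_norm M).
apply/eqP; rewrite -normr_eq0; apply/eqP/le_anti; rewrite normr_ge0 andbT.
apply/ler_addgt0Pr => e e0; rewrite add0r.
have C1 : 0 < C + 1 by rewrite ltr_wpDl.
have e' : 0 < e / (C + 1) by rewrite divr_gt0.
have [N _ hN] := near_infty_natSinv_lt (PosNum e').
have {}hN : N.+1%:R^-1 < e / (C + 1) by apply: (hN N); rewrite /=.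
apply: (le_trans (bound N)); apply: (@le_trans _ _ ((C + 1) * (e / (C + 1)))).
  by apply: ler_pM; rewrite ?invr_ge0 ?lerDl ?(ltW hN).
by rewrite mulrCA divff ?mulr1// lt0r_neq0.
Qed.

End profile_mean_value.

(** * Taylor estimates for powers of the positive part *)

Section positive_part.
Context {R : realType}.
Implicit Types a b S : R.

Lemma pos_part_lip a b : `|Num.max a 0 - Num.max b 0| <= `|a - b|.
Proof.
have [a0|a0] := leP a 0; have [b0|b0] := leP b 0;
  rewrite ?(subrr, normr0, sub0r, subr0, normrN)//.
- by rewrite (gtr0_norm b0) ler0_norm; lra.
- by rewrite (gtr0_norm a0) ger0_norm; lra.
Qed.

(** The derivative [2 * max b 0] is 2-Lipschitz, and the remainder constant is half of that,
    although the second derivative jumps at zero. *)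
Lemma pos_part_taylor2 a b :
  `|Num.max a 0 ^+ 2 - Num.max b 0 ^+ 2 - 2 * Num.max b 0 * (a - b)|
  <= (a - b) ^+ 2.
Proof.
have sq : 0 <= (a - b) ^+ 2 by exact: sqr_ge0.
have [a0|a0] := leP a 0; have [b0|b0] := leP b 0.
- by rewrite mulr0 mul0r subrr subr0 normr0.
- have ab : 0 <= - a * b by rewrite mulr_ge0; lra.
  have b2 : 0 <= b ^+ 2 by exact: sqr_ge0.
  have a2 : 0 <= a ^+ 2 by exact: sqr_ge0.
  rewrite (_ : _ - _ = b ^+ 2 - 2 * a * b); last by rewrite expr0n /=; ring.
  by rewrite ger0_norm; nra.
- have ab : 0 <= a * - b by rewrite mulr_ge0; lra.
  have b2 : 0 <= b ^+ 2 by exact: sqr_ge0.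
  have a2 : 0 <= a ^+ 2 by exact: sqr_ge0.
  rewrite (_ : _ - _ = a ^+ 2); last by rewrite expr0n /=; ring.
  by rewrite ger0_norm; nra.
- rewrite (_ : _ - _ = (a - b) ^+ 2); last by ring.
  by rewrite ger0_norm.
Qed.

(** Below [S] the second derivative [6 * max t 0] is at most [6 * S], and [3 * S] is half of it. *)
Lemma pos_part_taylor3 a b S : a <= S -> b <= S -> 0 <= S ->
  `|Num.max a 0 ^+ 3 - Num.max b 0 ^+ 3 - 3 * Num.max b 0 ^+ 2 * (a - b)|
  <= 3 * S * (a - b) ^+ 2.
Proof.
move=> aS bS S0.
have [a0|a0] := leP a 0; have [b0|b0] := leP b 0.
- rewrite !expr0n /= mulr0 mul0r !subr0 normr0.
  by rewrite mulr_ge0 ?sqr_ge0// mulr_ge0.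
- rewrite (_ : _ - _ = b ^+ 2 * (2 * b - 3 * a)); last by rewrite expr0n /=; ring.
  rewrite ger0_norm; last by rewrite mulr_ge0 ?sqr_ge0//; lra.
  have h1 : b ^+ 2 * b <= b ^+ 2 * S by rewrite ler_wpM2l ?sqr_ge0.
  have h2 : (- a * b) * b <= (- a * b) * S by rewrite ler_wpM2l// mulr_ge0; lra.
  have h3 : 0 <= S * a ^+ 2 by rewrite mulr_ge0 ?sqr_ge0.
  have h4 : 0 <= S * b ^+ 2 by rewrite mulr_ge0 ?sqr_ge0.
  have h5 : 0 <= S * (- a * b) by rewrite mulr_ge0// mulr_ge0; lra.
  nra.
- rewrite (_ : _ - _ = a ^+ 2 * a); last by rewrite !expr0n /=; ring.
  rewrite ger0_norm; last by rewrite mulr_ge0 ?sqr_ge0//; lra.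
  have h1 : a ^+ 2 * a <= a ^+ 2 * S by rewrite ler_wpM2l ?sqr_ge0.
  have h2 : a ^+ 2 <= (a - b) ^+ 2 by rewrite ler_pXn2r ?nnegrE //; lra.
  have h3 : S * a ^+ 2 <= S * (a - b) ^+ 2 by rewrite ler_wpM2l.
  have h4 : 0 <= S * (a - b) ^+ 2 by rewrite mulr_ge0 ?sqr_ge0.
  nra.
- rewrite (_ : _ - _ = (a + 2 * b) * (a - b) ^+ 2); last by ring.
  rewrite ger0_norm; last by rewrite mulr_ge0 ?sqr_ge0//; lra.
  by rewrite ler_wpM2r ?sqr_ge0//; lra.
Qed.

End positive_part.

(** * Locally Lipschitz functions *)

Section locally_lipschitz.
Context {R : realType} {m : nat}.
Local Notation V := 'rV[R]_m.

(** Only the base point is confined to a ball; the increment, of norm at most 1, is subtracted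
    because translating the centre [x] by [d] changes [y - x] by [- d]. *)
Definition llip (k : V -> R) : Prop := forall Z, exists2 L, 0 <= L &
  forall z d : V, `|z| <= Z -> `|d| <= 1 -> `|k (z - d) - k z| <= L * `|d|.

(** Walking from [z] to the origin in [n.+1] equal steps, each of norm at most 1, changes [k] by at
    most [L] per step and never leaves the ball of radius [Z]. *)
Lemma llip_bounded k : llip k -> forall Z, exists2 B, 0 <= B &
  forall z : V, `|z| <= Z -> `|k z| <= B.
Proof.
move=> lk Z; have [L L0 kL] := lk Z.
have [n Zn] : exists n : nat, Z <= n%:R.
  by exists (Num.bound `|Z|%R); exact/ltW/(le_lt_trans (ler_norm Z))/archi_boundP.
have : forall z : V, `|z| <= Z -> forall j, (j <= n.+1)%N ->
    `|k z - k ((1 - j%:R / n.+1%:R) *: z)| <= L * j%:R.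
  have n0 : 0 < n.+1%:R :> R by [].
  move=> z zZ; elim=> [|j IH] jn.
    by rewrite mul0r subr0 scale1r subrr normr0 mulr0.
  set y := (1 - j%:R / n.+1%:R) *: z.
  have jn1 : j%:R / n.+1%:R <= 1 :> R by rewrite ler_pdivrMr// mul1r ler_nat ltnW.
  have jn0 : 0 <= j%:R / n.+1%:R :> R by rewrite divr_ge0.
  have -> : (1 - j.+1%:R / n.+1%:R) *: z = y - n.+1%:R^-1 *: z.
    by rewrite /y -scalerBl -natr1 mulrDl mul1r opprD addrA.
  have yZ : `|y| <= Z.
    rewrite normrZ; apply: le_trans zZ; rewrite ler_piMl//.
    by rewrite ger0_norm ?subr_ge0// gerBl.
  have d1 : `|n.+1%:R^-1 *: z| <= 1.
    rewrite normrZ ger0_norm ?invr_ge0// mulrC ler_pdivrMr// mul1r.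
    by apply: (le_trans zZ); apply: (le_trans Zn); rewrite ler_nat.
  have h := kL y _ yZ d1.
  have -> : k z - k (y - n.+1%:R^-1 *: z) =
    (k z - k y) - (k (y - n.+1%:R^-1 *: z) - k y) by ring.
  apply: (le_trans (ler_normB _ _)); rewrite -(natr1 j) mulrDr mulr1.
  apply: lerD; first by apply: IH; exact: ltnW.
  by apply: (le_trans h); rewrite ler_piMr.
move=> H; exists (`|k 0| + L * n.+1%:R) => [|z zZ]; first by rewrite addr_ge0// mulr_ge0.
have := H z zZ n.+1 (leqnn _); rewrite divff ?lt0r_neq0// subrr scale0r => h.
rewrite -[k z](subrK (k 0)) addrC; apply: (le_trans (ler_normD _ _)).
by rewrite lerD2l.
Qed.

Lemma near_norm_le (z : V) (e : R) : 0 < e -> \forall y \near z, `|z - y| <= e.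
Proof.
move=> e0; apply/nbhs_ballP; exists e => //= y.
by rewrite mx_norm_ball /ball_ /=; exact: ltW.
Qed.

Lemma llip_continuous k : llip k -> continuous k.
Proof.
move=> lk z; have [L L0 kL] := lk `|z|; have L1 : 0 < L + 1 by rewrite ltr_wpDl.
apply/(@cvgrPdist_le _ R _ (nbhs z)) => e e0; near=> y.
have -> : y = z - (z - y) by rewrite subKr.
have d1 : `|z - y| <= 1 by near: y; exact: near_norm_le.
rewrite distrC; apply: (le_trans (kL _ _ (lexx _) d1)).
apply: (@le_trans _ _ ((L + 1) * (e / (L + 1)))); last first.
  by rewrite mulrCA divff ?mulr1// lt0r_neq0.
apply: ler_pM => //; first by lra.
by near: y; apply: near_norm_le; rewrite divr_gt0.
Unshelve. all: by end_near. Qed.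

Lemma llip_cst c : llip (fun=> c).
Proof. by move=> Z; exists 0 => // z d _ _; rewrite subrr normr0 mul0r. Qed.

Lemma llip_coord i : llip (fun z => z 0 i).
Proof.
move=> Z; exists 1 => // z d _ _; rewrite !mxE mul1r addrAC subrr sub0r normrN.
exact: rV_norm_entry.
Qed.

Lemma llipD k1 k2 : llip k1 -> llip k2 -> llip (fun z => k1 z + k2 z).
Proof.
move=> l1 l2 Z; have [L1 L10 h1] := l1 Z; have [L2 L20 h2] := l2 Z.
exists (L1 + L2) => [|z d zZ d1]; first by rewrite addr_ge0.
rewrite opprD addrACA mulrDl; apply: (le_trans (ler_normD _ _)).
by apply: lerD; [exact: h1|exact: h2].
Qed.

Lemma llipM k1 k2 : llip k1 -> llip k2 -> llip (fun z => k1 z * k2 z).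
Proof.
move=> l1 l2 Z; have [L1 L10 h1] := l1 Z; have [L2 L20 h2] := l2 Z.
have [B1 B10 b1] := llip_bounded l1 (Z + 1); have [B2 B20 b2] := llip_bounded l2 Z.
exists (B1 * L2 + L1 * B2) => [|z d zZ d1]; first by rewrite addr_ge0// mulr_ge0.
have -> : k1 (z - d) * k2 (z - d) - k1 z * k2 z =
  k1 (z - d) * (k2 (z - d) - k2 z) + (k1 (z - d) - k1 z) * k2 z by ring.
apply: (le_trans (ler_normD _ _)); rewrite !normrM mulrDl.
apply: lerD.
  rewrite -mulrA; apply: ler_pM => //; last exact: h2.
  by apply: b1; apply: (le_trans (ler_normB _ _)); exact: lerD.
by rewrite [L1 * B2 * _]mulrAC; apply: ler_pM => //; [exact: h1|exact: b2].
Qed.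

Lemma llip_sum (I : Type) (s : seq I) (k : I -> V -> R) :
  (forall i, llip (k i)) -> llip (fun z => \sum_(i <- s) k i z).
Proof.
move=> lk; elim: s => [|i s IH].
  rewrite (_ : (fun z => _) = fun=> 0); first exact: llip_cst.
  by apply/funext => z; rewrite big_nil.
rewrite (_ : (fun z => _) = fun z => k i z + \sum_(j <- s) k j z).
  exact: llipD.
by apply/funext => z; rewrite big_cons.
Qed.

Lemma tauE rho (z : V) :
  tau rho (enorm z) = Num.max (rho ^+ 2 - \sum_(i < m) z 0 i ^+ 2) 0.
Proof. by rewrite /tau sqr_enorm. Qed.

(** Only the square of [enorm] enters, so this is the positive part, a 1-Lipschitz operation, of a
    polynomial in the coordinates. *)
Lemma llip_tau rho : llip (fun z => tau rho (enorm z)).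
Proof.
have lq : llip (fun z : V => rho ^+ 2 + (-1) * \sum_(i < m) z 0 i ^+ 2).
  apply: llipD; first exact: llip_cst.
  apply: llipM; first exact: llip_cst.
  by apply: llip_sum => i; under eq_fun do rewrite expr2; apply: llipM; exact: llip_coord.
move=> Z; have [L L0 h] := lq Z; exists L => // z d zZ d1.
rewrite !tauE; apply: (le_trans (pos_part_lip _ _)).
by have := h z d zZ d1; rewrite !mulN1r.
Qed.

Lemma llip_tauX rho k : llip (fun z => tau rho (enorm z) ^+ k).
Proof.
elim: k => [|k IH].
  by under eq_fun do rewrite expr0; exact: llip_cst.
by under eq_fun do rewrite exprS; apply: llipM => //; exact: llip_tau.
Qed.

End locally_lipschitz.

(** * Derivatives from quadratic remainders *)

Section derive_quadratic.
Context {R : realType} {m : nat}.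
Local Notation V := 'rV[R]_m.

Lemma is_derive_quadratic (f : V -> R) (x v : V) (l C : R) : 0 <= C ->
  (forall h : R, `|h| <= 1 -> `|f (h *: v + x) - f x - h * l| <= C * h ^+ 2) ->
  is_derive x v f l.
Proof.
move=> C0 fC; have C1 : 0 < C + 1 by rewrite ltr_wpDl.
have cv : h^-1 *: ((f \o shift x) (h *: v) - f x) @[h --> 0^'] --> l.
  apply/cvgrPdist_le => e e0; near=> h.
  have h0 : h != 0 by near: h; exact: nbhs_dnbhs_neq.
  have h1 : `|h| <= 1.
    near: h; apply: dnbhs0_le; exact: ltr01.
  have he : `|h| <= e / (C + 1).
    by near: h; apply: dnbhs0_le; rewrite divr_gt0.
  rewrite /= -[l](mulKf h0) /GRing.scale /= -mulrBr normrM normfV distrC.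
  rewrite mulrC ler_pdivrMr ?normr_gt0//; apply: (le_trans (fC h h1)).
  rewrite -real_normK ?num_real// expr2 mulrA ler_wpM2r//.
  apply: (@le_trans _ _ ((C + 1) * (e / (C + 1)))); last first.
    by rewrite mulrCA divff ?mulr1// lt0r_neq0.
  by apply: ler_pM => //; lra.
apply: DeriveDef; first exact: cvgP cv.
exact: cvg_lim cv.
Unshelve. all: by end_near. Qed.

End derive_quadratic.

(** * Convolution with a locally Lipschitz kernel *)

Section convolution.
Context {R : realType} {m : nat}.
Local Notation V := 'rV[R]_m.
Variables (x0 : V) (eta M : R) (u : V -> R).
Hypothesis eta_gt0 : 0 < eta.
Hypothesis bu : bcont x0 eta M u.

Let ut (y : V) : R := (`|y - x0| < eta)%R%:R * u y.

Definition kern (k : V -> R) : Prop :=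
  llip k /\ exists K, forall z, `|k z| <= K.

(** The cutoff is centred at [x0], not at [x], so [x] occurs in the kernel alone and regularity in
    [x] is that of [k]. *)
Definition conv (k : V -> R) (x : V) : R :=
  rint (fun y => k (y - x) * ((`|y - x0| < eta)%R%:R * u y)).

Lemma radm_conv k x : kern k -> radm (fun y => k (y - x) * ut y).
Proof.
move=> [lk [K kK]].
apply: (radm_mul (K := K) _ _ (radm_restrict bu)) => //.
apply: rmeas_continuous => y.
apply: (@continuous_comp _ _ _ (fun y : V => y - x) k).
  by apply: continuousB => //; exact: cst_continuous.
exact: llip_continuous.
Qed.

Lemma norm_rint_restrict (f : V -> R) B : 0 <= B ->
  radm (fun y => f y * ut y) ->
  (forall y, `|y - x0| < eta -> `|f y| <= B) ->
  `|rint (fun y => f y * ut y)| <= B * (`|M| * (eta *+ 2) ^+ m).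
Proof.
move=> B0 af fB; have ac := radm_cube x0 eta.
have -> : B * (`|M| * (eta *+ 2) ^+ m) =
    rint (fun y => (B * `|M|) * cube x0 eta y + 0 * cube x0 eta y).
  by rewrite rint_linear// mul0r addr0 rint_cube ?mulrA// ltW.
apply: norm_rint_le => //; first exact: radm_linear.
move=> y; rewrite mul0r addr0 /ut /cube.
case: ltP => [h|_]; last first.
  by rewrite mul0r mulr0 normr0 !mulr_ge0.
rewrite (ltW h) mul1r mulr1 normrM; apply: ler_pM => //; first exact: fB.
by have [_ /le_trans->//] := bu h; exact: ler_norm.
Qed.

Lemma conv_linear a b k1 k2 x : kern k1 -> kern k2 ->
  conv (fun z => a * k1 z + b * k2 z) x = a * conv k1 x + b * conv k2 x.
Proof.
move=> h1 h2; rewrite /conv -rint_linear; [|exact: radm_conv..].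
by congr rint; apply/funext => y; ring.
Qed.

Lemma norm_sub_le (x y : V) Z : `|x| <= Z -> `|y - x0| < eta ->
  `|y - x| <= Z + `|x0| + eta.
Proof.
move=> xZ yx; have -> : y - x = (y - x0) + x0 - x by rewrite subrK.
apply: (le_trans (ler_normB _ _)); have := ler_normD (y - x0) x0; lra.
Qed.

(** This is the source of continuity for the partial derivatives of [u], which turn out to be such
    convolutions. *)
Lemma llip_conv k : kern k -> llip (conv k).
Proof.
move=> kk Z; have [L L0 kL] := kk.1 (Z + `|x0| + eta).
exists (L * (`|M| * (eta *+ 2) ^+ m)) => [|x d xZ d1].
  by rewrite !mulr_ge0// exprn_ge0// mulrn_wge0// ltW.
have E : (fun y => (k (y - (x - d)) - k (y - x)) * ut y) =
   (fun y => 1 * (k (y - (x - d)) * ut y) + (-1) * (k (y - x) * ut y)).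
  by apply/funext => y; ring.
have -> : conv k (x - d) - conv k x =
    rint (fun y => (k (y - (x - d)) - k (y - x)) * ut y).
  by rewrite E rint_linear ?mul1r ?mulN1r//; exact: radm_conv.
rewrite mulrAC; apply: norm_rint_restrict; first by rewrite mulr_ge0.
  by rewrite E; apply: radm_linear; exact: radm_conv.
move=> y yx; have -> : y - (x - d) = (y - x) - (- d) by rewrite !opprB opprK addrA addrAC.
by rewrite -[`|d|]normrN; apply: kL; rewrite ?normrN//; exact: norm_sub_le.
Qed.

(** The remainder is uniform over a ball containing every [y - x] that the cutoff admits, so it can
    be integrated. Here [k'] is minus the derivative of [k] along [v], as [x] enters through
    [y - x]. *)
Lemma is_derive_conv k k' (v x : V) : kern k -> kern k' ->
  (forall Z, exists2 C, 0 <= C & forall (z : V) (h : R), `|z| <= Z -> `|h| <= 1 ->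
    `|k (z - h *: v) - k z - h * k' z| <= C * h ^+ 2) ->
  is_derive x v (conv k) (conv k' x).
Proof.
move=> kk kk' H; have [C C0 kC] := H (`|x| + `|x0| + eta).
apply: (@is_derive_quadratic _ _ _ _ _ _ (C * (`|M| * (eta *+ 2) ^+ m))) => [|h h1].
  by rewrite !mulr_ge0// exprn_ge0// mulrn_wge0// ltW.
have E : (fun y => (k ((y - x) - h *: v) - k (y - x) - h * k' (y - x)) * ut y) =
   (fun y => 1 * (1 * (k (y - (h *: v + x)) * ut y) + (-1) * (k (y - x) * ut y))
      + (- h) * (k' (y - x) * ut y)).
  by apply/funext => y; rewrite opprD [in RHS]addrA [in RHS](addrAC y); ring.
have -> : conv k (h *: v + x) - conv k x - h * conv k' x =
    rint (fun y => (k ((y - x) - h *: v) - k (y - x) - h * k' (y - x)) * ut y).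
  rewrite E rint_linear; [|apply: radm_linear; exact: radm_conv|exact: radm_conv].
  by rewrite rint_linear; [rewrite !mul1r mulN1r mulNr|exact: radm_conv..].
rewrite mulrAC; apply: norm_rint_restrict.
- by rewrite mulr_ge0// sqr_ge0.
- by rewrite E; do 2 ?[apply: radm_linear]; exact: radm_conv.
by move=> y yx; apply: kC => //; exact: norm_sub_le.
Qed.

End convolution.

(** * The kernel and its first two derivatives *)

Section bump_kernel.
Context {R : realType} {m : nat}.
Local Notation V := 'rV[R]_m.
Variable rho : R.
Hypothesis rho_gt0 : 0 < rho.

Let T (z : V) : R := tau rho (enorm z).

(* [bump1 i] and [bump2 i j] are derivatives of [fun x => bump (y - x)], not of
   [bump], hence the sign of [bump1]. *)
Definition bump (z : V) : R := tau rho (enorm z) ^+ 3.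
Definition bump1 (i : 'I_m) (z : V) : R := 6 * z 0 i * tau rho (enorm z) ^+ 2.
Definition bump2 (i j : 'I_m) (z : V) : R :=
  24 * z 0 i * z 0 j * tau rho (enorm z)
  - 6 * (i == j)%:R * tau rho (enorm z) ^+ 2.

(** A factor [T] confines the support to the ball of radius [rho], where local boundedness is
    enough. *)
Lemma kern_tau (k : V -> R) (p : V -> R) : llip p ->
  (forall z, k z = p z * T z) -> kern k.
Proof.
move=> lp kE; have lk : llip k.
  have -> : k = fun z => p z * T z by apply/funext.
  by apply: llipM => //; exact: llip_tau.
split => //; have [B B0 kB] := llip_bounded lk rho.
exists B => z; have [zr|zr] := leP (enorm z) rho.
  by apply: kB; apply: le_trans zr; exact: rV_norm_le_enorm.
by rewrite kE /T tau_out ?mulr0 ?normr0// ltW.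
Qed.

Lemma kern_tauX k : (0 < k)%N -> kern (fun z : V => tau rho (enorm z) ^+ k).
Proof.
case: k => // k _; apply: (kern_tau (llip_tauX rho k)) => z.
by rewrite exprSr.
Qed.

Lemma kern_bump1 i : kern (bump1 i).
Proof.
apply: (@kern_tau _ (fun z => (6 * z 0 i) * T z)).
  by do 2 ?[apply: llipM]; [exact: llip_cst|exact: llip_coord|exact: llip_tau].
by move=> z; rewrite /bump1 /T; ring.
Qed.

Lemma kern_bump2 i j : kern (bump2 i j).
Proof.
apply: (@kern_tau _ (fun z => (24 * z 0 i) * z 0 j + (- (6 * (i == j)%:R)) * T z)).
  apply: llipD; apply: llipM; [|exact: llip_coord|exact: llip_cst|exact: llip_tau].
  by apply: llipM; [exact: llip_cst|exact: llip_coord].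
by move=> z; rewrite /bump2 /T; ring.
Qed.

(** The polynomial of which [T] is the positive part. Its increments are computed exactly, and the
    estimates for the positive part carry them over to [T]. *)
Let q (z : V) : R := rho ^+ 2 - \sum_(i < m) z 0 i ^+ 2.

Let qE (z : V) h j : q (z - h *: delta_mx 0 j) - q z = 2 * h * z 0 j - h ^+ 2.
Proof.
rewrite /q (bigD1 j)//= [in X in _ - X](bigD1 j)//= !mxE !eqxx mulr1.
rewrite (eq_bigr (fun i => z 0 i ^+ 2)); last first.
  by move=> i ij; rewrite !mxE (negPf ij) mulr0 subr0.
ring.
Qed.

Let q_le z : q z <= rho ^+ 2.
Proof. by rewrite /q gerBl sumr_ge0// => i _; exact: sqr_ge0. Qed.

Let qdiff_le (z : V) h j Z : `|z| <= Z -> `|h| <= 1 ->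
  `|2 * h * z 0 j - h ^+ 2| <= `|h| * (2 * Z + 1).
Proof.
move=> zZ h1; rewrite (_ : _ - _ = h * (2 * z 0 j - h)); last by ring.
rewrite normrM ler_wpM2l//; apply: (le_trans (ler_normB _ _)).
rewrite normrM [`|2|]ger0_norm//; have := rV_norm_entry z j; lra.
Qed.

Let Tle (z : V) : T z <= rho ^+ 2. Proof. exact: tau_le. Qed.
Let Tge0 (z : V) : 0 <= T z. Proof. exact: tau_ge0. Qed.

Let sqr_le_abs (a b : R) : `|a| <= b -> a ^+ 2 <= b ^+ 2.
Proof.
by move=> ab; rewrite -real_normK ?num_real// ler_pXn2r// nnegrE// (le_trans _ ab).
Qed.

Lemma bump_taylor (j : 'I_m) Z : exists2 C, 0 <= C &
  forall (z : V) (h : R), `|z| <= Z -> `|h| <= 1 ->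
    `|bump (z - h *: delta_mx 0 j) - bump z - h * bump1 j z| <= C * h ^+ 2.
Proof.
have S0 : 0 <= rho ^+ 2 by exact: sqr_ge0.
(* The first term is the cubic Taylor remainder with [S = rho ^+ 2] and an increment of [q] at most
   [|h| * (2 * Z + 1)]; the second comes from the part [- h ^+ 2] of that increment. *)
exists (3 * rho ^+ 2 * (2 * Z + 1) ^+ 2 + 3 * (rho ^+ 2) ^+ 2).
  by apply: addr_ge0; apply: mulr_ge0; rewrite ?sqr_ge0// mulr_ge0.
move=> z h zZ h1; rewrite /bump /bump1 -!/(T _).
set a := q (z - h *: delta_mx 0 j); set b := q z.
have Ta : T (z - h *: delta_mx 0 j) = Num.max a 0 by rewrite /T tauE.
have Tb : T z = Num.max b 0 by rewrite /T tauE.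
have ab : a - b = 2 * h * z 0 j - h ^+ 2 by exact: qE.
have := pos_part_taylor3 (q_le (z - h *: delta_mx 0 j)) (q_le z) S0.
rewrite -/a -/b -Ta -Tb => h3.
rewrite (_ : _ - _ - _ = (T (z - h *: delta_mx 0 j) ^+ 3 - T z ^+ 3 - 3 * T z ^+ 2 * (a - b))
  - 3 * T z ^+ 2 * h ^+ 2); last by rewrite ab; ring.
apply: (le_trans (ler_normB _ _)); rewrite [leRHS]mulrDl; apply: lerD.
  apply: (le_trans h3); rewrite -(mulrA (3 * rho ^+ 2)); apply: ler_wpM2l.
    by rewrite mulr_ge0.
  rewrite ab (_ : _ * h ^+ 2 = (`|h| * (2 * Z + 1)) ^+ 2); last first.
    by rewrite exprMn real_normK ?num_real// mulrC.
  exact/sqr_le_abs/qdiff_le.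
rewrite ger0_norm; last by rewrite !(sqr_ge0, mulr_ge0).
rewrite ler_wpM2r ?sqr_ge0// ler_wpM2l//; apply: sqr_le_abs.
by rewrite ger0_norm.
Qed.

Lemma bump1_taylor (i j : 'I_m) Z : exists2 C, 0 <= C &
  forall (z : V) (h : R), `|z| <= Z -> `|h| <= 1 ->
    `|bump1 i (z - h *: delta_mx 0 j) - bump1 i z - h * bump2 i j z| <= C * h ^+ 2.
Proof.
have S0 : 0 <= rho ^+ 2 by exact: sqr_ge0.
set S := rho ^+ 2 in S0.
(* The part with factor [|Z|] bounds [z 0 i] times the Taylor error of [T ^+ 2]; the last part
   bounds the product of the increments of the two factors of [bump1]. *)
pose C := 6 * (`|Z| * ((2 * `|Z| + 1) ^+ 2 + 2 * S) + 2 * S * (2 * `|Z| + 1)).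
exists C.
  have Z1 : 0 <= 2 * `|Z| + 1 by rewrite addr_ge0// mulr_ge0.
  have S2 : 0 <= 2 * S by rewrite mulr_ge0.
  rewrite /C mulr_ge0//; apply: addr_ge0; apply: mulr_ge0 => //.
  by apply: addr_ge0 => //; exact: sqr_ge0.
move=> z h zZ h1; rewrite /bump1 /bump2 -!/(T _).
have {}zZ : `|z| <= `|Z| by apply: (le_trans zZ); exact: ler_norm.
set z' := z - h *: delta_mx 0 j.
have z'i : z' 0 i = z 0 i - h * (i == j)%:R by rewrite !mxE eqxx.
set a := q z'; set b := q z.
have Ta : T z' = Num.max a 0 by rewrite /T tauE.
have Tb : T z = Num.max b 0 by rewrite /T tauE.
have ab : a - b = 2 * h * z 0 j - h ^+ 2 by exact: qE.
have abn : `|a - b| <= `|h| * (2 * `|Z| + 1) by rewrite ab; exact: qdiff_le.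
have := pos_part_taylor2 a b; have := pos_part_lip a b.
rewrite -Ta -Tb z'i; set D := (i == j)%:R; set ta := T z'; set tb := T z => p1 p2.
have ta0 : 0 <= ta by exact: Tge0.
have tb0 : 0 <= tb by exact: Tge0.
have taS : ta <= S by exact: Tle.
have tbS : tb <= S by exact: Tle.
have D1 : `|D| <= 1 by rewrite /D; case: (i == j); rewrite ?normr1 ?normr0.
rewrite (_ : _ - _ - _ = 6 * (z 0 i * ((ta ^+ 2 - tb ^+ 2 - 2 * tb * (a - b)) - 2 * tb * h ^+ 2)
  - (h * D) * ((ta + tb) * (ta - tb)))); last by rewrite ab; ring.
rewrite normrM [`|6|]ger0_norm// /C -[leRHS]mulrA ler_wpM2l// [leRHS]mulrDl.
have hh : h ^+ 2 = `|h| ^+ 2 by rewrite real_normK ?num_real.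
apply: (le_trans (ler_normB _ _)); apply: lerD.
  rewrite normrM -[leRHS]mulrA; apply: ler_pM => //.
    by apply: le_trans zZ; exact: rV_norm_entry.
  apply: (le_trans (ler_normB _ _)); rewrite [leRHS]mulrDl; apply: lerD.
    apply: (le_trans p2); rewrite hh mulrC -exprMn.
    exact: sqr_le_abs.
  rewrite ger0_norm; last by rewrite !(sqr_ge0, mulr_ge0).
  by rewrite ler_wpM2r ?sqr_ge0// ler_wpM2l.
rewrite !normrM (_ : 2 * S * (2 * `|Z| + 1) * h ^+ 2 =
  (`|h| * 1) * ((2 * S) * (`|h| * (2 * `|Z| + 1)))); last by rewrite hh; ring.
apply: ler_pM => //; first exact: ler_wpM2l.
apply: ler_pM => //; last exact: le_trans p1 abn.
by rewrite ger0_norm; lra.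
Qed.

Lemma sum_bump2 (z : V) : \sum_(i < m) bump2 i i z =
  24 * rho ^+ 2 * tau rho (enorm z) - (24 + 6 * m%:R) * tau rho (enorm z) ^+ 2.
Proof.
rewrite /bump2 -!/(T _) sumrB.
have -> : \sum_(i < m) 24 * z 0 i * z 0 i * T z = 24 * enorm z ^+ 2 * T z.
  by rewrite sqr_enorm mulr_sumr mulr_suml; apply: eq_bigr => i _; ring.
have -> : \sum_(i < m) 6 * (i == i)%:R * T z ^+ 2 = m%:R * (6 * T z ^+ 2).
  rewrite (eq_bigr (fun=> 6 * T z ^+ 2)) => [|i _].
    by rewrite sumr_const card_ord [RHS]mulr_natl.
  by rewrite eqxx mulr1.
(* Inside the ball [|z|^2 = rho^2 - T z]; outside it both sides have the factor [T z = 0]. *)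
have -> : 24 * enorm z ^+ 2 * T z = 24 * (rho ^+ 2 - T z) * T z.
  rewrite /T /tau; case: leP => h; first by rewrite !mulr0.
  by rewrite opprB addrCA subrr addr0.
ring.
Qed.

End bump_kernel.

(** * Finite sums of kernels *)

Section kernel_sums.
Context {R : realType} {m : nat}.
Local Notation V := 'rV[R]_m.
Variables (x0 : V) (eta M : R) (u : V -> R).
Hypothesis bu : bcont x0 eta M u.

Lemma kern_linear a b (k1 k2 : V -> R) : kern k1 -> kern k2 ->
  kern (fun z => a * k1 z + b * k2 z).
Proof.
move=> [l1 [B1 b1]] [l2 [B2 b2]]; split.
  by apply: llipD; apply: llipM => //; exact: llip_cst.
exists (`|a| * B1 + `|b| * B2) => z; apply: (le_trans (ler_normD _ _)).
by rewrite !normrM; apply: lerD; exact: ler_wpM2l.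
Qed.

Lemma conv_sum (I : Type) (s : seq I) (k : I -> V -> R) x :
  (forall i, kern (k i)) ->
  kern (fun z => \sum_(i <- s) k i z) /\
  conv x0 eta u (fun z => \sum_(i <- s) k i z) x
  = \sum_(i <- s) conv x0 eta u (k i) x.
Proof.
move=> kk; elim: s => [|i s [IH1 IH2]].
  rewrite (_ : (fun z => _) = fun=> 0); last by apply/funext => z; rewrite big_nil.
  split; first by split; [exact: llip_cst|exists 0 => z; rewrite normr0].
  rewrite big_nil /conv -[RHS](@rint0 R m); congr rint.
  by apply/funext => y; rewrite mul0r.
rewrite (_ : (fun z => _) = fun z => 1 * k i z + 1 * \sum_(j <- s) k j z); last first.
  by apply/funext => z; rewrite big_cons !mul1r.
split; first exact: kern_linear.
by rewrite (conv_linear bu)// !mul1r IH2 big_cons.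
Qed.

End kernel_sums.

(** * Local smoothness and the Laplacian *)

Section local_regularity.
Context {R : realType} {m : nat}.
Local Notation V := 'rV[R]_m.
Hypothesis m_gt0 : (0 < m)%N.
Variables (x0 : V) (eta delta rho M : R) (u : V -> R).
Hypothesis eta_gt0 : 0 < eta.
Hypothesis delta_gt0 : 0 < delta.
Hypothesis rho_gt0 : 0 < rho.
Hypothesis bu : bcont x0 eta M u.
Hypothesis near_inside : forall x : V, `|x - x0| < delta -> inside x0 eta x rho.
Hypothesis ball_mean : forall x : V, `|x - x0| < delta ->
  forall r : R, 0 < r -> r <= rho ->
  shell `]-oo, r[ x u - u x * shell `]-oo, r[ x (fun=> 1) = 0.

Let b1 := @bcont_cst R m x0 eta 1.

Let radm_tauX k x M' w : (0 < k)%N -> `|x - x0| < delta -> bcont x0 eta M' w ->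
  radm (fun y => tau rho (enorm (y - x)) ^+ k * w y).
Proof.
move=> k0 xd bw.
apply: (radm_radial (measurable_tauX rho k) (fun t => norm_tauX_le rho t k) _
  (near_inside xd) bw).
by move=> t rt; rewrite tau_out ?ltW// expr0n eqn0Ngt k0.
Qed.

Let rad_linear (phi : R -> R) x a b (w1 w2 : V -> R) :
  radm (fun y => phi (enorm (y - x)) * w1 y) ->
  radm (fun y => phi (enorm (y - x)) * w2 y) ->
  rad phi x (fun y => a * w1 y + b * w2 y) = a * rad phi x w1 + b * rad phi x w2.
Proof.
move=> h1 h2; rewrite /rad -rint_linear//; congr rint.
by apply/funext => y; ring.
Qed.

Lemma tauX_mean_value k x : (0 < k)%N -> `|x - x0| < delta ->
  rad (fun t => tau rho t ^+ k) x u
  = u x * rad (fun t => tau rho t ^+ k) x (fun=> 1).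
Proof.
move=> k0 xd; have ix := near_inside xd.
(* With the value at the centre subtracted, the integrals over balls vanish, as [tauX_mean]
   requires; the coefficients match [rad_linear]. *)
pose w y := 1 * u y + (- u x) * 1.
have bw : bcont x0 eta (M + `|u x|) w.
  move=> y /bu[cu uM]; split.
    rewrite /w; under [X in {for _, continuous X}]eq_fun do rewrite mul1r mulr1.
    by apply: continuousB => //; exact: cst_continuous.
  rewrite /w mul1r mulr1; apply: (le_trans (ler_normB _ _)); exact: lerD.
have := tauX_mean rho_gt0 ix bw _ k0.
rewrite rad_linear; [|exact: radm_tauX bu|exact: radm_tauX b1].
rewrite mul1r mulNr => H; apply: subr0_eq; apply: H => r r0 rr.
rewrite /shell rad_linear; first by rewrite mul1r mulNr; exact: ball_mean.
- by apply: radm_shell ix bu => t; rewrite in_itv /=; lra.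
- by apply: radm_shell ix b1 => t; rewrite in_itv /=; lra.
Qed.

(** The ball of radius [rho] about [x] lies where the cutoff equals 1, so for these kernels the
    cutoff is invisible. *)
Lemma conv_tauX k x : (0 < k)%N -> `|x - x0| < delta ->
  conv x0 eta u (fun z => tau rho (enorm z) ^+ k) x
  = u x * rad (fun t => tau rho t ^+ k) x (fun=> 1).
Proof.
move=> k0 xd; rewrite -tauX_mean_value//; congr rint; apply/funext => y.
case: ltP => [_|h]; first by rewrite mul1r.
rewrite tau_out ?expr0n ?eqn0Ngt ?k0 ?mul0r//; first exact: ltW.
by rewrite leNgt; apply/negP => /ltW/(near_inside xd); rewrite ltNge h.
Qed.

Definition bump_mass : R := rad (fun t => tau rho t ^+ 3) x0 (fun=> 1).

Let x0d : `|x0 - x0| < delta. Proof. by rewrite subrr normr0. Qed.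

Lemma bump_mass_gt0 : 0 < bump_mass.
Proof.
have ix := near_inside x0d.
have r0 := rho_gt0.
have irho (t : R) : t \in `]-oo, rho / 2[ -> t <= rho by rewrite in_itv /=; lra.
have V0 : 0 < shell `]-oo, rho / 2[ x0 (fun=> 1).
  apply: (shell_ann_gt0 (r1 := 0) (r2 := rho / 2) m_gt0 _ irho _ ix) => [|t].
    by rewrite lexx divr_gt0.
  by rewrite in_itv /= => /andP[].
have t0 : 0 < tau rho (rho / 2) ^+ 3.
  rewrite exprn_gt0// /tau lt_max; apply/orP; left.
  have : 0 < rho ^+ 2 by rewrite exprn_gt0.
  by rewrite expr_div_n; lra.
apply: (lt_le_trans (mulr_gt0 t0 V0)).
have ai := radm_shell irho ix b1.
have -> : tau rho (rho / 2) ^+ 3 * shell `]-oo, rho / 2[ x0 (fun=> 1) =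
  rint (fun y => tau rho (rho / 2) ^+ 3 * ((enorm (y - x0) \in `]-oo, rho / 2[)%:R * 1)
     + 0 * ((enorm (y - x0) \in `]-oo, rho / 2[)%:R * 1)).
  by rewrite rint_linear// mul0r addr0.
apply: le_rint; first exact: radm_linear.
  exact: radm_tauX b1.
move=> y; rewrite mul0r addr0 !mulr1 in_itv /=.
case: ltP => h; last by rewrite mulr0 exprn_ge0// tau_ge0.
rewrite mulr1; apply: lerXn2r; rewrite ?nnegrE ?tau_ge0// /tau.
have e0 := enorm_ge0 (y - x0).
have h2 : enorm (y - x0) ^+ 2 <= (rho / 2) ^+ 2.
  by apply: lerXn2r; rewrite ?nnegrE ?divr_ge0// ltW.
by rewrite ge_max !le_max lexx orbT andbT lerD2l lerN2 h2.
Qed.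

(** By translation invariance the normalising factor does not vary with [x], so it can be taken out
    of every derivative. *)
Lemma rad_bump_mass (x : V) : rad (fun t => tau rho t ^+ 3) x (fun=> 1) = bump_mass.
Proof.
have E (z : V) : rad (fun t => tau rho t ^+ 3) z (fun=> 1) =
    rint (fun y : V => tau rho (enorm y) ^+ 3).
  rewrite -(@rint_shift _ _ (fun y : V => tau rho (enorm y) ^+ 3) (- z)).
    by congr rint; apply/funext => y; rewrite mulr1.
  apply: rmeas_continuous; apply: llip_continuous; exact: llip_tauX.
by rewrite /bump_mass !E.
Qed.

Lemma conv_bump x : `|x - x0| < delta ->
  u x = bump_mass^-1 * conv x0 eta u (bump rho) x.
Proof.
move=> xd; rewrite /bump conv_tauX// rad_bump_mass mulrCA mulVf ?mulr1//.
exact: lt0r_neq0 bump_mass_gt0.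
Qed.

Lemma near_delta x : `|x - x0| < delta -> \forall y \near x, `|y - x0| < delta.
Proof.
move=> xd; apply/nbhs_ballP; exists (delta - `|x - x0|) => /=; first by rewrite subr_gt0.
move=> y; rewrite mx_norm_ball /ball_ /= distrC ltrBrDr; apply: le_lt_trans.
by rewrite -[y - x0](subrKA x); exact: ler_normD.
Qed.

Let is_derive_scaled (f g : V -> R) (x v : V) l :
  (\forall y \near x, f y = bump_mass^-1 * g y) -> is_derive x v g l ->
  is_derive x v f (bump_mass^-1 * l).
Proof.
move=> fg dg; have := @is_deriveZ _ _ _ g bump_mass^-1 x v l dg.
apply: near_eq_is_derive; near=> y; apply/esym.
by near: y; exact: fg.
Unshelve. all: by end_near. Qed.

(** Stated at every [x] of the neighbourhood, not only at [x0]: the first partials are then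
    convolutions near each point and can be differentiated again. *)
Let du x i : `|x - x0| < delta ->
  is_derive x (ebasis R i) u (bump_mass^-1 * conv x0 eta u (bump1 rho i) x).
Proof.
move=> xd; apply: (is_derive_scaled (g := conv x0 eta u (bump rho))).
  by apply: filterS (near_delta xd) => y; exact: conv_bump.
apply: is_derive_conv => //; [exact: bu|exact: kern_tauX|exact: kern_bump1|].
exact: bump_taylor.
Qed.

Let partialE x i : `|x - x0| < delta ->
  partial i u x = bump_mass^-1 * conv x0 eta u (bump1 rho i) x.
Proof. by move=> xd; have [] := du i xd. Qed.

Let ddu x i j : `|x - x0| < delta ->
  is_derive x (ebasis R j) (partial i u)
    (bump_mass^-1 * conv x0 eta u (bump2 rho i j) x).
Proof.
move=> xd; apply: (is_derive_scaled (g := conv x0 eta u (bump1 rho i))).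
  by apply: filterS (near_delta xd) => y; exact: partialE.
apply: is_derive_conv => //; [exact: bu|exact: kern_bump1|exact: kern_bump2|].
exact: bump1_taylor.
Qed.

Let partial2E x i j : `|x - x0| < delta ->
  partial j (partial i u) x = bump_mass^-1 * conv x0 eta u (bump2 rho i j) x.
Proof. by move=> xd; have [] := ddu i j xd. Qed.

Let continuous_scaled (f : V -> R) k : kern k ->
  (forall y, `|y - x0| < delta -> f y = bump_mass^-1 * conv x0 eta u k y) ->
  {for x0, continuous f}.
Proof.
move=> kk fE.
have ck : {for x0, continuous (fun y => bump_mass^-1 * conv x0 eta u k y)}.
  by apply: continuousM; [exact: cst_continuous|
    exact: (llip_continuous (llip_conv eta_gt0 bu kk))].
have e : \forall y \near x0, bump_mass^-1 * conv x0 eta u k y = f y.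
  by apply: filterS (near_delta x0d) => y /fE ->.
change (f y @[y --> x0] --> f x0); rewrite (fE x0 x0d).
exact: (cvg_trans (near_eq_cvg e) ck).
Qed.

Lemma local_C2 :
  {for x0, continuous u} /\
  forall i : 'I_m,
    derivable u x0 (ebasis R i) /\ {for x0, continuous (partial i u)} /\
    forall j : 'I_m,
      derivable (partial i u) x0 (ebasis R j) /\
      {for x0, continuous (partial j (partial i u))}.
Proof.
split; first by have [|] := bu (y := x0); rewrite ?subrr ?normr0.
move=> i; split; first by have [] := du i x0d.
split; first by apply: (continuous_scaled (kern_bump1 rho_gt0 i)) => y; exact: partialE.
move=> j; split; first by have [] := ddu i j x0d.
by apply: (continuous_scaled (kern_bump2 rho_gt0 i j)) => y; exact: partial2E.
Qed.

(* The factor of [u x0] is the same for all [u]: it vanishes, as [u = 1] shows. *)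
Lemma local_laplacian : bump_mass * laplacian u x0 =
  u x0 * (24 * rho ^+ 2 * rad (fun t => tau rho t ^+ 1) x0 (fun=> 1)
          - (24 + 6 * m%:R) * rad (fun t => tau rho t ^+ 2) x0 (fun=> 1)).
Proof.
rewrite /laplacian (eq_bigr (fun i => bump_mass^-1 * conv x0 eta u (bump2 rho i i) x0)); last first.
  by move=> i _; exact: partial2E.
rewrite -mulr_sumr mulVKf; last exact: lt0r_neq0 bump_mass_gt0.
have [_ <-] := conv_sum bu (index_enum _) x0 (fun i => kern_bump2 rho_gt0 i i).
rewrite (_ : (fun z => _) = fun z => (24 * rho ^+ 2) * (tau rho (enorm z) ^+ 1) +
    (- (24 + 6 * m%:R)) * tau rho (enorm z) ^+ 2); last first.
  by apply/funext => z; rewrite sum_bump2 expr1 mulNr.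
rewrite (conv_linear bu); [|exact: kern_tauX..].
by rewrite !conv_tauX//; ring.
Qed.

End local_regularity.

(** * Application to the annulus identity *)

Section annulus_to_shell.
Context {R : realType} {m : nat}.
Local Notation V := 'rV[R]_m.

Lemma Rm_integral_annulus (x : V) (r1 r2 : R) (w : V -> R) :
  Rm_integral (annulus x r1 r2) w = shell `]r1, r2[ x w.
Proof.
apply: eq_iint => s _; congr (_ * _).
rewrite indicE in_itv /=; congr (_%:R); congr nat_of_bool.
have -> : enorm (row_of_seq m s - x) = enorm (x - row_of_seq m s).
  by rewrite -enormN opprB.
by apply/idP/idP => [/set_mem//|h]; rewrite inE.
Qed.

Definition annulus_hypothesis (D : set V) (u : V -> R) : Prop :=
  (forall x r1 r2, D x -> 0 < r1 -> r1 < r2 -> eclosed_ball x r2 `<=` D ->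
      forall r, r1 < r < r2 -> annulus_sphere_identity u x r1 r2 r)
  \/ (forall x r1 r2, D x -> 0 < r1 -> r1 < r2 -> eclosed_ball x r2 `<=` D ->
      annulus_sphere_identity u x r1 r2 r1)
  \/ (forall x r1 r2, D x -> 0 < r1 -> r1 < r2 -> eclosed_ball x r2 `<=` D ->
      annulus_sphere_identity u x r1 r2 r2).

Lemma annulus_ball_mean (D : set V) (u : V -> R) (x0 x : V) (eta M rho : R) :
  (0 < m)%N -> 0 < rho -> annulus_hypothesis D u ->
  inside x0 eta x rho -> (forall y, `|y - x0| < eta -> D y) ->
  bcont x0 eta M u -> forall r : R, 0 < r -> r <= rho ->
  shell `]-oo, r[ x u - u x * shell `]-oo, r[ x (fun=> 1) = 0.
Proof.
move=> m0 rho0 H ix OD bu.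
pose K r := sphere_integral x r u / (omega R m * r ^+ m.-1).
have Dx : D x.
  apply/OD/ix; rewrite subrr (_ : enorm (0 : V) = 0) ?ltW//.
  by rewrite /enorm big1 ?sqrtr0// => i _; rewrite mxE expr0n.
have ball (r2 : R) : r2 <= rho -> eclosed_ball x r2 `<=` D.
  by move=> r2rho y /= yr; apply/OD/ix/(le_trans yr).
have [|c Hc] := annulus_mean_const m0 ix bu (K := K).
  by case: H => [H|[H|H]]; [apply: Or31|apply: Or32|apply: Or33];
    move=> r1 r2 r10 r12 r2rho; rewrite -!Rm_integral_annulus;
    [move=> r rr|..]; apply: H => //; exact: ball.
have Hb := ball_mean_const m0 rho0 ix bu Hc.
by rewrite -(ball_mean_value m0 rho0 ix bu Hb).
Qed.

End annulus_to_shell.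

(** * Harmonicity *)

Theorem theorem1p3 (R : realType) (m : nat) (hm : (2 <= m)%N)
    (D : set 'rV[R]_m) (u : 'rV[R]_m -> R) :
  bounded_domain D ->
  (forall x, D x -> {for x, continuous u}) ->
  ((forall x r1 r2, D x -> 0 < r1 -> r1 < r2 -> eclosed_ball x r2 `<=` D ->
      forall r, r1 < r < r2 -> annulus_sphere_identity u x r1 r2 r)
   \/ (forall x r1 r2, D x -> 0 < r1 -> r1 < r2 -> eclosed_ball x r2 `<=` D ->
      annulus_sphere_identity u x r1 r2 r1)
   \/ (forall x r1 r2, D x -> 0 < r1 -> r1 < r2 -> eclosed_ball x r2 `<=` D ->
      annulus_sphere_identity u x r1 r2 r2)) ->
  harmonic_on D u.
Proof.
move=> [oD _] cu H.
have m0 : (0 < m)%N by exact: ltnW.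
suff local x0 : D x0 ->
    ({for x0, continuous u} /\ forall i : 'I_m,
      derivable u x0 (ebasis R i) /\ {for x0, continuous (partial i u)} /\
      forall j : 'I_m, derivable (partial i u) x0 (ebasis R j) /\
        {for x0, continuous (partial j (partial i u))}) /\ laplacian u x0 = 0.
  by split=> x /local[].
move=> Dx0.
(* Openness of [D] and continuity at [x0] give a neighbourhood inside [D] on which [u] is
   bounded. *)
have [eta /= eta0 Beta] : exists2 e : R, 0 < e & forall y, `|y - x0| < e ->
    D y /\ `|u y| <= `|u x0| + 1.
  have nD : \forall y \near x0, D y by exact: open_nbhs_nbhs.
  have nu : \forall y \near x0, `|u y| <= `|u x0| + 1.
    have := cu x0 Dx0 => /cvgrPdist_le /(_ 1 ltr01); apply: filterS => y h.
    rewrite -[u y](subrK (u x0)) addrC; apply: (le_trans (ler_normD _ _)).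
    by rewrite lerD2l distrC.
  have /nbhs_ballP[e /= e0 eB] : \forall y \near x0, D y /\ `|u y| <= `|u x0| + 1.
    by apply: filterS2 nD nu.
  exists e => // y h; apply: eB.
  by rewrite mx_norm_ball /ball_ /= distrC.
have bu : bcont x0 eta (`|u x0| + 1) u by move=> y /Beta[/cu].
have b1 := @bcont_cst R m x0 eta 1.
(* Since [eta / 2 + eta / 4 < eta], balls of radius [eta / 4] centred within [eta / 2] of [x0] stay
   in the neighbourhood. *)
have d0 : 0 < eta / 2 by rewrite divr_gt0.
have r0 : 0 < eta / 4 by rewrite divr_gt0.
have ins x : `|x - x0| < eta / 2 -> inside x0 eta x (eta / 4).
  move=> xd y yr; have h := rV_norm_le_enorm (y - x).
  have := ler_normD (y - x) (x - x0); rewrite subrKA; lra.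
have mean x : `|x - x0| < eta / 2 -> forall r : R, 0 < r -> r <= eta / 4 ->
    shell `]-oo, r[ x u - u x * shell `]-oo, r[ x (fun=> 1) = 0.
  move=> xd; apply: (annulus_ball_mean m0 r0 H (ins x xd) _ bu).
  by move=> y /Beta[].
split; first exact: (local_C2 m0 eta0 d0 r0 bu ins mean).
have mean1 x : `|x - x0| < eta / 2 -> forall r : R, 0 < r -> r <= eta / 4 ->
    shell `]-oo, r[ x (fun=> 1) - 1 * shell `]-oo, r[ x (fun=> 1) = 0.
  by move=> *; rewrite mul1r subrr.
have lap := local_laplacian m0 eta0 d0 r0 bu ins mean.
(* The function 1 is taken at the same [x0] and radius, so the factor obtained is literally that of
   [lap]. *)
have := local_laplacian m0 eta0 d0 r0 b1 ins mean1.
have -> : laplacian (fun=> 1) x0 = 0.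
  rewrite /laplacian big1// => i _; rewrite /partial.
  rewrite (_ : (fun x => 'D_(ebasis R i) (fun=> 1 : R) x) = fun=> 0) ?derive_cst//.
  by apply/funext => x; rewrite derive_cst.
rewrite mulr0 mul1r => k0; move: lap; rewrite -k0 mulr0 => /eqP.
rewrite mulf_eq0 => /orP[/eqP h|/eqP//].
by have := bump_mass_gt0 m0 d0 r0 ins; rewrite h ltxx.
Qed.
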